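(* Let $2\le k\le n$, $f(y)=f_0(|y|)$ for $|y|>1$ ($y\in\mathbb R^n$), so that $(Q_-f)(x,\xi)=\Phi_-(t)$ is a function of $t=2|x|-1>1$ only. Suppose that $$\int_1^A |f_0(s)|\,(s^2-1)^{(k-3)/2}\,s\,ds<\infty\quad\text{for every }A>1,$$ and let $$H(v)=\frac{\pi^{1/2}}{\Gamma(k/2)}\left(\frac{v-1}{2}\right)^{k-2}\Phi_-(\sqrt v),\qquad v>1.$$ Then $f_0(s)$ can be reconstructed for almost all $s>1$ by the formula $$f_0(s)=(s^2-1)^{(3-k)/2}\,(\mathcal D^{(k-1)/2}_{1+}H)(s^2).$$
   Context: For $x\in\mathbb R^n\setminus\{0\}$, $G^x_{n,k}$ is the set of all $k$-dimensional linear subspaces of $\mathbb R^n$ containing $x$; $\sigma_{k-1}=2\pi^{k/2}/\Gamma(k/2)$. For $|x|>1$, $\xi\in G^x_{n,k}$, $$(Q_-f)(x,\xi)=\frac{1}{\sigma_{k-1}}\int_{\mathbb S^{n-1}\cap\xi} f(x+(|x|-1)\theta)\,d\theta,$$ with $d\theta$ the surface area measure on $\mathbb S^{n-1}\cap\xi$. Left-sided Riemann–Liouville fractional integral and derivative with left endpoint $a$: for $\alpha>0$, $(I^\alpha_{a+}\varphi)(x)=\frac1{\Gamma(\alpha)}\int_a^x \varphi(y)(x-y)^{\alpha-1}dy$; writing $\alpha=m+\alpha_0$ with $m=[\alpha]$ the integer part and $0\le\alpha_0<1$, $(\mathcal D^\alpha_{a+}\varphi)(x)=(d/dx)^{m+1}(I^{1-\alpha_0}_{a+}\varphi)(x)$.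 Here $a=1$. *)

(* Defs.v *)
From HB Require Import structures.
From mathcomp Require Import all_boot all_order all_algebra.
From mathcomp Require Import all_classical all_reals all_analysis.
From mathcomp Require Import measurable_realfun.

Set Implicit Arguments.
Unset Strict Implicit.
Unset Printing Implicit Defensive.

Import Order.TTheory GRing.Theory Num.Theory.
Import numFieldTopology.Exports numFieldNormedType.Exports.

Local Open Scope classical_set_scope.
Local Open Scope ring_scope.

(* The norm that the library puts on 'rV[R]_n is the sup norm, hence the
   explicit Euclidean norm. It is stated for coordinate functions so that it
   serves both x : 'rV[R]_n, as [l2norm (x 0)], and y : k.-tuple R, as
   [l2norm (tnth y)]. *)
Definition l2norm (R : realType) n (v : 'I_n -> R) : R :=
  Num.sqrt (\sum_(i < n) v i ^+ 2).

Definition enorm (R : realType) n (x : 'rV[R]_n) : R := l2norm (x 0).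

Definition dotp (R : realType) n (x y : 'rV[R]_n) : R :=
  \sum_(i < n) x 0 i * y 0 i.

(* Euler's Gamma function, for 0 < a. *)
Definition Gamma (R : realType) (a : R) : R :=
  \int[lebesgue_measure]_(t in `]0, +oo[) (t `^ (a - 1) * expR (- t)).

(* For 1 <= k, the total area of the unit sphere of R^k, i.e. sigma_(k-1). *)
Definition sphere_total_area (R : realType) (k : nat) : R :=
  2 * pi `^ (k%:R / 2) / Gamma (k%:R / 2).

(* The library has no Lebesgue measure on k.-tuple R: [lebesgue_tuple] below is
   the iterated product measure, each step being the image of a binary product
   under cons. *)
Definition cons_pair (R : realType) k (p : R * k.-tuple R) : k.+1.-tuple R :=
  [the k.+1.-tuple R of p.1 :: p.2].

Lemma measurable_cons_pair (R : realType) k :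
  measurable_fun setT (@cons_pair R k).
Proof. by apply: measurable_cons. Qed.

Section cons_measure.
Context (R : realType) (k : nat).
Variable mu : {sigma_finite_measure set (k.-tuple R) -> \bar R}.

Definition cons_measure : set (k.+1.-tuple R) -> \bar R :=
  pushforward (lebesgue_measure \x mu)%E (@cons_pair R k).

Let cons_measure0 : cons_measure set0 = 0%E.
Proof. by rewrite /cons_measure /pushforward preimage_set0 measure0. Qed.

Let cons_measure_ge0 A : (0 <= cons_measure A)%E.
Proof. by rewrite /cons_measure /pushforward measure_ge0. Qed.

Let cons_measure_sigma_additive : semi_sigma_additive cons_measure.
Proof.
pose m := measure_function_pushforward__canonical__measure_function_Measure
  (lebesgue_measure \x mu)%E (@measurable_cons_pair R k).
exact: (@measure_semi_sigma_additive _ _ _ m).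
Qed.

HB.instance Definition _ := isMeasure.Build _ _ _ cons_measure
  cons_measure0 cons_measure_ge0 cons_measure_sigma_additive.

Let cons_measure_sigma_finite : sigma_finite setT cons_measure.
Proof.
have /sigma_finiteP[F [FT ndF Foo]] := sigma_finiteT (@lebesgue_measure R).
have /sigma_finiteP[G [GT ndG Goo]] := sigma_finiteT mu.
pose uncons (y : k.+1.-tuple R) : R * k.-tuple R :=
  (thead y, [tuple of behead y]).
have consK : cancel (@cons_pair R k) uncons.
  by move=> [a y]; congr pair; apply/val_inj.
have muncons : measurable_fun setT uncons.
  apply/measurable_fun_pairP; split.
    exact: (@measurable_tnth _ R k.+1 ord0).
  exact: measurable_behead.
exists (fun i => uncons @^-1` (F i `*` G i)).
  apply/esym; rewrite -subTset => y _.
  have [i _ Fi] : (\bigcup_i F i) (uncons y).1 by rewrite -FT.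
  have [j _ Gj] : (\bigcup_i G i) (uncons y).2 by rewrite -GT.
  exists (maxn i j) => //; split.
    by move: Fi; exact/subsetPset/ndF/leq_maxl.
  by move: Gj; exact/subsetPset/ndG/leq_maxr.
move=> i; have [mF Fi] := Foo i; have [mG Gi] := Goo i; split.
  by rewrite -[X in measurable X]setTI; apply: muncons => //; exact: measurableX.
rewrite /cons_measure /pushforward -comp_preimage.
rewrite (_ : uncons \o _ = idfun); last by apply/funext => p /=; rewrite consK.
by rewrite preimage_id product_measure1E// lte_mul_pinfty// ge0_fin_numE.
Qed.

HB.instance Definition _ := Measure_isSigmaFinite.Build _ _ _ cons_measure
  cons_measure_sigma_finite.

End cons_measure.

Section point_measure.
Context (R : realType).

Definition point_measure : set (0.-tuple R) -> \bar R := dirac [tuple].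

HB.instance Definition _ := Measure.on point_measure.

Let point_measure_sigma_finite : sigma_finite setT point_measure.
Proof.
by apply: fin_num_fun_sigma_finite; [rewrite measure0|exact: fin_num_measure].
Qed.

HB.instance Definition _ := Measure_isSigmaFinite.Build _ _ _ point_measure
  point_measure_sigma_finite.

End point_measure.

Fixpoint lebesgue_tuple (R : realType) (k : nat) :
    {sigma_finite_measure set (k.-tuple R) -> \bar R} :=
  match k return {sigma_finite_measure set (k.-tuple R) -> \bar R} with
  | 0 => @point_measure R
  | k'.+1 => cons_measure (lebesgue_tuple R k')
  end.

Definition direction (R : realType) k (y : k.-tuple R) : k.-tuple R :=
  [tuple tnth y i / l2norm (tnth y) | i < k].

Definition unit_ball (R : realType) k : set (k.-tuple R) :=
  [set y | l2norm (tnth y) <= 1].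

Definition unit_sphere (R : realType) k : set (k.-tuple R) :=
  [set y | l2norm (tnth y) = 1].

Lemma measurable_l2norm (R : realType) k :
  measurable_fun setT (fun y : k.-tuple R => l2norm (tnth y)).
Proof.
apply: (measurableT_comp (f := fun t : R => Num.sqrt t)).
  by apply: continuous_measurable_fun; exact: sqrt_continuous.
apply: measurable_sum => i; apply: measurable_funX.
exact: measurable_tnth.
Qed.

Lemma measurable_unit_ball (R : realType) k : measurable (@unit_ball R k).
Proof.
have := @measurable_l2norm R k measurableT _ (@measurable_itv _ `]-oo, 1%R]).
rewrite setTI (_ : _ @^-1` _ = @unit_ball R k)//.
Qed.

Lemma measurable_direction (R : realType) k :
  measurable_fun setT (@direction R k).
Proof.
apply/measurable_fun_tnthP => i.
rewrite (_ : _ \o _ =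
    fun y : k.-tuple R => tnth y i * l2norm (tnth y) `^ (-1)).
  apply: measurable_funM; first exact: measurable_tnth.
  apply: (measurableT_comp (f := fun t : R => t `^ (-1))) => //.
  exact: measurable_l2norm.
apply/funext => y /=; rewrite tnth_mktuple powR_inv1//.
exact: sqrtr_ge0.
Qed.

Section sphere_area.
Context (R : realType) (k : nat).

(* The surface area measure on the unit sphere of R^k (1 <= k), defined
   through polar coordinates: the area of A is k times the volume of the cone
   {r theta : 0 < r <= 1, theta \in A}. (The vertex is a null set.) *)
Definition sphere_area (A : set (k.-tuple R)) : \bar R :=
  (k%:R%:E * lebesgue_tuple R k (@direction R k @^-1` A `&` @unit_ball R k))%E.

Let sphere_area0 : sphere_area set0 = 0%E.
Proof. by rewrite /sphere_area preimage_set0 set0I measure0 mule0. Qed.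

Let sphere_area_ge0 A : (0 <= sphere_area A)%E.
Proof. by rewrite mule_ge0. Qed.

Let sphere_area_sigma_additive : semi_sigma_additive sphere_area.
Proof.
pose m := measure_function_pushforward__canonical__measure_function_Measure
  (mrestr (lebesgue_tuple R k) (@measurable_unit_ball R k))
  (@measurable_direction R k).
exact: (@measure_semi_sigma_additive _ _ _ (mscale k%:R%:nng m)).
Qed.

HB.instance Definition _ := isMeasure.Build _ _ _ sphere_area
  sphere_area0 sphere_area_ge0 sphere_area_sigma_additive.

End sphere_area.

Definition orthonormal_basis (R : realType) n (xi : {vspace 'rV[R]_n})
    (e : (\dim xi).-tuple 'rV[R]_n) : Prop :=
  (forall i j, dotp (tnth e i) (tnth e j) = (i == j)%:R) /\ <<e>>%VS = xi.

(* Surface integral over the unit sphere of the subspace xi, transported from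
   R^k, k = \dim xi, by an isometry sending the canonical basis to an
   orthonormal basis of xi. The choice of that basis is immaterial, as
   [sphere_area] is rotation invariant. *)
Definition sphere_integral (R : realType) n (xi : {vspace 'rV[R]_n})
    (g : 'rV[R]_n -> R) : R :=
  let e := xget [tuple of nseq (\dim xi) 0] [set e | orthonormal_basis e] in
  \int[@sphere_area R (\dim xi)]_(c in @unit_sphere R (\dim xi))
    g (\sum_(i < \dim xi) tnth c i *: tnth e i).

Definition Qminus (R : realType) n (f : 'rV[R]_n -> R)
    (x : 'rV[R]_n) (xi : {vspace 'rV[R]_n}) : R :=
  (sphere_total_area R (\dim xi))^-1 *
  sphere_integral xi (fun theta => f (x + (enorm x - 1) *: theta)).

(* Riemann-Liouville integral and derivative of order alpha > 0 with left
   endpoint a, at points x > a. *)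
Definition RL_integral (R : realType) (alpha a : R) (phi : R -> R) (x : R) : R :=
  (Gamma alpha)^-1 *
  \int[lebesgue_measure]_(y in `]a, x[) (phi y * (x - y) `^ (alpha - 1)).

Definition RL_primitive (R : realType) (alpha a : R) (phi : R -> R) : R -> R :=
  RL_integral (1 - (alpha - (Num.truncn alpha)%:R)) a phi.

Definition RL_derivative (R : realType) (alpha a : R) (phi : R -> R) : R -> R :=
  derive1n (Num.truncn alpha).+1 (RL_primitive alpha a phi).

(* Integrals and derivatives are total in the library; this says that those in
   [RL_derivative alpha a phi x] exist: with m the integer part of alpha, the
   integral converges near x, its first m derivatives exist near x, and the
   (m+1)-st exists at x. *)
Definition RL_derivable (R : realType) (alpha a : R) (phi : R -> R) (x : R) :
    Prop :=
  let m := Num.truncn alpha in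
  let g := RL_primitive alpha a phi in
  [/\ \forall z \near x, lebesgue_measure.-integrable `]a, z[
        (fun y => (phi y * (z - y) `^ (- (alpha - m%:R)))%:E),
      forall j, (j < m)%N -> \forall z \near x, derivable (derive1n j g) z 1
    & derivable (derive1n m g) x 1].

(* On R, [measurable_fun] refers to the Borel sigma-algebra; a function is
   Lebesgue measurable on a Borel set D iff it agrees there with a Borel
   function up to a null set. The library's integral of a nonnegative function
   is the supremum of the integrals of the Borel simple functions below it, so
   it remains the Lebesgue integral for such functions. *)
Definition Lebesgue_measurable (R : realType) (D : set R) (f : R -> R) : Prop :=
  exists2 g : R -> R, measurable_fun D g &
    {ae lebesgue_measure, forall s, D s -> f s = g s}.

(* Main.v *)
Require Import Defs.
From HB Require Import structures.
From mathcomp Require Import all_boot all_order all_algebra.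
From mathcomp Require Import all_classical all_reals all_analysis.
From mathcomp Require Import measurable_realfun.
From mathcomp Require Import ring lra.

(* In polar coordinates around the direction of x, a point x + (|x| - 1) theta of
   the sphere has squared norm y = 1 + b + b u, where b = 2 |x| (|x| - 1) and u is
   the cosine of the angle; as u has density proportional to
   (1 - u^2)^((k-3)/2), the function H is, up to the stated constants, the
   Riemann-Liouville integral of order (k-1)/2 of
   phi(y) = f0 (sqrt y) (y - 1)^((k-3)/2). The semigroup property turns the
   further fractional integration in the derivative into an iterated primitive
   of phi, and Lebesgue's differentiation theorem gives phi back almost
   everywhere.

   The density of u is computed from the iterated Lebesgue measure: in R^k,
   (<e, y>, |y|^2) has the same law as (|e| y_0, |y|^2), and |y|^2 has density
   pi^(k/2) / Gamma(k/2) r^(k/2 - 1), by convolution of one-dimensional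
   densities, that is, by the relation between Beta and Gamma integrals. *)

Set Implicit Arguments.
Unset Strict Implicit.
Unset Printing Implicit Defensive.

Import Order.TTheory GRing.Theory Num.Theory.
Import numFieldTopology.Exports numFieldNormedType.Exports.

Local Open Scope classical_set_scope.
Local Open Scope ring_scope.

(** * Change of variables *)

(** Two obstacles shape the proof. The profile [f0] is only Lebesgue measurable and [f] is
    unspecified where |y| <= 1, so the integrand on the sphere need not be Borel: [f0] is replaced
    by a Borel version, and exceptional null sets are transported to the sphere, where the cosine
    has a density, and through s -> s^2 in both directions. Moreover the integrals are total and may
    diverge, so the identities are proved in the extended reals for nonnegative functions, then for
    positive and negative parts separately; the formula for Q_- thus holds at every x, not only for
    almost every radius. Powers are extended by zero to the negative half-line, which makes
    fractional integrals convolutions over R. All orders are half-integers; the parity of k decides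
    whether the last integration has order 1/2 or 1. A single order may be 1/2, with an unbounded
    kernel, but the sum of two orders is at least 1, which gives the semigroup law at every
    point. *)

Section change_of_variables.
Context d1 d2 (X : measurableType d1) (Y : measurableType d2) (R : realType).
Variables (m1 : {measure set X -> \bar R}) (m2 : {measure set Y -> \bar R}).
Variables (phi : X -> Y) (h : X -> R).
Hypotheses (mphi : measurable_fun setT phi) (mh : measurable_fun setT h).
Hypothesis h0 : forall x, 0 <= h x.
Local Open Scope ereal_scope.
Hypothesis hm : forall A, measurable A ->
  \int[m1]_(x in phi @^-1` A) (h x)%:E = m2 A.

Import HBNNSimple.

(** The hypothesis on sets is the case of an indicator; linearity gives simple functions, and
    monotone convergence gives [G]. *)
Lemma ge0_change_of_variables (G : Y -> \bar R) :
  measurable_fun setT G -> (forall y, 0 <= G y) ->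
  \int[m1]_x (G (phi x) * (h x)%:E) = \int[m2]_y G y.
Proof.
move=> mG G0; pose g := nnsfun_approx measurableT mG.
have cvgg y : (EFin \o g ^~ y) n @[n --> \oo] --> G y.
  by apply: cvg_nnsfun_approx.
have mpre A : measurable A -> measurable (phi @^-1` A).
  by move=> mA; rewrite -[X in measurable X]setTI; exact: mphi.
transitivity (limn (fun n => \int[m1]_x ((g n (phi x))%:E * (h x)%:E))).
  rewrite -monotone_convergence//.
  - apply: eq_integral => x _; apply/esym/cvg_lim => //.
    by apply: cvgeZr => //; exact: cvgg.
  - move=> n; apply: emeasurable_funM; last exact/measurable_EFinP.
    by apply/measurable_EFinP; apply: measurableT_comp.
  - by move=> n x _; rewrite mule_ge0// lee_fin.
  - move=> x _ m n mn; apply: lee_wpmul2r; rewrite lee_fin//.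
    exact/lefP/nd_nnsfun_approx.
transitivity (limn (fun n => \int[m2]_y (g n y)%:E)); last first.
  rewrite -monotone_convergence//.
  - by apply: eq_integral => y _; apply/cvg_lim => //; exact: cvgg.
  - by move=> n; exact/measurable_EFinP.
  - by move=> n x _; rewrite lee_fin.
  - by move=> x _ m n mn; rewrite lee_fin; exact/lefP/nd_nnsfun_approx.
congr (limn _); apply/funext => n.
have mh' r : measurable_fun setT
    (fun x => (r * \1_(g n @^-1` [set r]) (phi x))%:E * (h x)%:E).
  apply: emeasurable_funM; last exact/measurable_EFinP.
  apply/measurable_EFinP; apply: measurable_funM => //.
  by apply: measurableT_comp => //; exact: measurable_indic.
transitivity (\sum_(r \in range (g n))
    \int[m1]_x ((r * \1_(g n @^-1` [set r]) (phi x))%:E * (h x)%:E)).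
  rewrite -ge0_integral_fsum//.
    apply: eq_integral => x _.
    rewrite -ge0_mule_fsuml; last by move=> r; rewrite EFinM nnfun_muleindic_ge0.
    by rewrite fsumEFin// -fimfunE.
  by move=> r x _; rewrite mule_ge0 ?lee_fin// -lee_fin EFinM nnfun_muleindic_ge0.
transitivity (\sum_(r \in range (g n))
    \int[m2]_y (r * \1_(g n @^-1` [set r]) y)%:E); last first.
  rewrite -ge0_integral_fsum//.
  - by apply: eq_integral => y _; rewrite fsumEFin// -fimfunE.
  - move=> r; apply/measurable_EFinP; apply: measurable_funM => //.
  - by move=> r x _; rewrite EFinM nnfun_muleindic_ge0.
apply: eq_fsbigr => r /[1!inE] -[y _ <-].
set A := g n @^-1` _.
have mA : measurable A by exact: measurable_sfunP.
under eq_integral do rewrite EFinM -muleA.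
under [RHS]eq_integral do rewrite EFinM.
have mI : measurable_fun setT (fun y => (\1_A y : R)%:E).
  by apply/measurable_EFinP; exact: measurable_indic.
rewrite [LHS]ge0_integralZl//; last 3 first.
- apply: emeasurable_funM; last exact/measurable_EFinP.
  exact: measurableT_comp mI mphi.
- by move=> x _; rewrite mule_ge0 ?lee_fin.
- by rewrite lee_fin.
rewrite [RHS]ge0_integralZl//; last by rewrite lee_fin.
congr (_ * _); rewrite integral_indic// setIT -hm// [RHS]integral_mkcond.
apply: eq_integral => x _; rewrite patchE indicE.
rewrite (_ : (x \in phi @^-1` A) = (phi x \in A)); last first.
  by apply/idP/idP; rewrite !inE.
by case: ifPn => _ /=; rewrite ?mul1e ?mul0e.
Qed.

End change_of_variables.

(** * Substitutions on the real line *)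

Section lebesgue_substitution.
Context (R : realType).
Notation mu := (@lebesgue_measure R).

Lemma integral_exprn (n : nat) (a b : R) : a <= b ->
  (\int[mu]_(x in `]a, b]) (n.+1%:R * x ^+ n)%:E =
   (b ^+ n.+1 - a ^+ n.+1)%:E)%E.
Proof.
rewrite le_eqVlt => /predU1P[<-|ab]; first by rewrite set_itvoc0 integral_set0 subrr.
rewrite integral_itv_obnd_cbnd; last first.
  by apply/measurable_EFinP/measurable_funTS/measurable_funM => //; exact: measurable_funX.
rewrite (@continuous_FTC2 _ _ (fun x : R => x ^+ n.+1))//.
- apply: continuous_subspaceT => x.
  by apply: cvgM; [exact: cvg_cst|exact: exprn_continuous].
- split; first by move=> x _; exact: exprn_derivable.
  + by apply: cvg_at_right_filter; exact: exprn_continuous.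
  + by apply: cvg_at_left_filter; exact: exprn_continuous.
- by move=> x _; rewrite exp_derive1.
Qed.

Section density_measure.
Variables (phi h : R -> R).
Hypotheses (mphi : measurable_fun setT phi) (mh : measurable_fun setT h).
Hypothesis h0 : forall x, 0 <= h x.

Definition density_pushforward (A : set (measurableTypeR R)) : \bar R :=
  (\int[mu]_(x in phi @^-1` A) (h x)%:E)%E.

Let density_pushforward0 : density_pushforward set0 = 0%E.
Proof. by rewrite /density_pushforward preimage_set0 integral_set0. Qed.

Let density_pushforward_ge0 A : (0 <= density_pushforward A)%E.
Proof. by apply: integral_ge0 => x _; rewrite lee_fin. Qed.

Let density_pushforward_sigma_additive : semi_sigma_additive density_pushforward.
Proof.
move=> F mF tF mUF; rewrite /density_pushforward preimage_bigcup.
have mpre i : measurable (phi @^-1` F i).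
  by have := mphi measurableT (mF i); rewrite setTI.
rewrite ge0_integral_bigcup//; last 3 first.
- by apply/measurable_EFinP/measurable_funTS.
- by move=> x _; rewrite lee_fin.
- by move=> i j _ _ [x [Fi Fj]]; apply: tF => //; exists (phi x).
by apply: is_cvg_nneseries => n _ _; exact: density_pushforward_ge0.
Qed.

HB.instance Definition _ := isMeasure.Build _ _ _ density_pushforward
  density_pushforward0 density_pushforward_ge0
  density_pushforward_sigma_additive.

Local Open Scope ereal_scope.

(** The image under [phi] of the measure with density [h] agrees with Lebesgue measure on half-open
    intervals, hence is equal to it by uniqueness. *)
Lemma ge0_lebesgue_substitution :
  (forall a b : R, (a <= b)%R ->
     \int[mu]_(x in phi @^-1` `]a, b]) (h x)%:E = (b - a)%:E) ->
  forall G : R -> \bar R, measurable_fun setT G -> (forall y, 0 <= G y) ->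
  \int[mu]_x (G (phi x) * (h x)%:E) = \int[mu]_y G y.
Proof.
move=> hab G mG G0; apply: ge0_change_of_variables => // A mA.
apply/esym.
pose m : {measure set (measurableTypeR R) -> \bar R} := density_pushforward.
apply: (@lebesgue_measure_unique _ m) => //.
move=> _ [[a b] _ <-]; rewrite /= /density_pushforward lebesgue_measure_itv/= lte_fin.
have [ab|ba] := ltP a b; first by rewrite hab ?EFinB// ltW.
by rewrite set_itv_ge ?bnd_simp -?leNgt// preimage_set0 integral_set0.
Qed.

End density_measure.

Local Open Scope ereal_scope.
Variable G : R -> \bar R.
Hypotheses (mG : measurable_fun setT G) (G0 : forall y, 0 <= G y).

Lemma ge0_integral_affine (a b : R) : (0 < a)%R ->
  \int[mu]_x (G (a * x + b)%R * a%:E) = \int[mu]_x G x.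
Proof.
move=> a0; apply: (@ge0_lebesgue_substitution (fun x => a * x + b)%R (fun=> a)) => //.
- by apply: measurable_funD => //; apply: measurable_funM.
- by move=> _; exact: ltW.
move=> c d cd.
rewrite (_ : _ @^-1` _ = [set` `]((c - b) / a)%R, ((d - b) / a)%R]]); last first.
  apply/seteqP; split => x /=; rewrite !in_itv/= ltr_pdivrMr// ler_pdivlMr//;
    rewrite (mulrC x) ltrBlDr lerBrDr//.
rewrite integral_cst//= lebesgue_measure_itv/= lte_fin.
rewrite ltr_pM2r ?invr_gt0// ltrD2r; have [lt_cd|] := ltP c d.
  by rewrite -EFinD -EFinM; congr EFin; field; rewrite gt_eqF.
by move=> dc; rewrite mule0 (@le_anti _ _ c d) ?cd// subrr.
Qed.

Lemma ge0_integral_scale (a : R) : (0 < a)%R ->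
  \int[mu]_x (G (a * x)%R * a%:E) = \int[mu]_x G x.
Proof.
move=> a0; rewrite -(ge0_integral_affine 0 a0).
by apply: eq_integral => x _; rewrite addr0.
Qed.

Lemma ge0_integral_shift (b : R) :
  \int[mu]_x G (x + b)%R = \int[mu]_x G x.
Proof.
rewrite -(ge0_integral_affine b ltr01).
by apply: eq_integral => x _; rewrite mul1r mule1.
Qed.

Lemma ge0_integral_opp : \int[mu]_x G (- x)%R = \int[mu]_x G x.
Proof.
rewrite -[RHS](@ge0_lebesgue_substitution -%R (fun=> 1)%R) //.
- by apply: eq_integral => x _; rewrite mule1.
- move=> a b ab; rewrite opp_preimage_itvbndbnd integral_cst// mul1e.
  rewrite /= lebesgue_measure_itv/= lte_fin ltrN2.
  have [lt_ab|ba] := ltP a b; first by rewrite -EFinD opprK addrC.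
  by rewrite (@le_anti _ _ a b) ?ab// subrr.
Qed.

(** No sign condition on [a] and [b]: the square root is 0 on negative numbers. *)
Let sqrt_itv (a b x : R) : (0 < x ->
  (a < x ^+ 2 <= b) = (Num.sqrt a < x <= Num.sqrt b))%R.
Proof.
move=> x0; have x20 : (0 < x ^+ 2)%R by rewrite exprn_gt0.
rewrite [in RHS](_ : x = Num.sqrt (x ^+ 2)); last by rewrite sqrtr_sqr gtr0_norm.
rewrite ltr_sqrt//; congr (_ && _).
have [b0|b0] := leP 0%R b; first by rewrite ler_sqrt.
rewrite (ler0_sqrtr (ltW b0)) !leNgt sqrtr_gt0 x20/=.
by rewrite (lt_trans b0).
Qed.

Lemma ge0_integral_sqr :
  \int[mu]_(x in `]0%R, +oo[) (G (x ^+ 2)%R * (2 * x)%:E) =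
  \int[mu]_(x in `]0%R, +oo[) G x.
Proof.
(* Squaring is continued by the identity on the nonpositive half-line, which gives a bijection of R,
   so the substitution rule on the whole line applies. *)
pose phi (x : R) : R := if (0 < x)%R then (x ^+ 2)%R else x.
pose h (x : R) : R := if (0 < x)%R then (2 * x)%R else 1%R.
have mpos : measurable_fun [set: R] (fun x : R => (0 < x)%R).
  exact: measurable_fun_ltr.
have mphi : measurable_fun setT phi.
  by apply: measurable_fun_ifT => //; exact: measurable_funX.
have mh : measurable_fun setT h.
  by apply: measurable_fun_ifT => //; exact: measurable_funM.
have mGp : measurable_fun setT (G \_ `]0%R, +oo[).
  apply/(measurable_restrictT _ _).1 => //; exact: measurable_funTS.
rewrite integral_mkcond [RHS]integral_mkcond.
rewrite -[RHS](@ge0_lebesgue_substitution phi h)//; last 3 first.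
- by move=> x; rewrite /h; case: ifPn => // x0; rewrite mulr_ge0// ltW.
- move=> a b ab; rewrite (_ : _ @^-1` _ =
    [set` `](Num.min a 0)%R, (Num.min b 0)%R]] `|` [set` `](Num.sqrt a), (Num.sqrt b)]]); last first.
    apply/seteqP; split => x; rewrite /phi /= !in_itv/=.
      case: ifPn => x0; first by rewrite sqrt_itv//; right.
      by move: x0; rewrite -leNgt => x0 /andP[ax xb]; left; rewrite gt_min ax le_min xb.
    case; last first.
      move=> /andP[ax xb]; have x0 : (0 < x)%R by rewrite (le_lt_trans _ ax).
      by rewrite x0 sqrt_itv// ax.
    rewrite gt_min le_min => /andP[ax /andP[xb x0]].
    rewrite ifN -?leNgt// xb andbT.
    by move: ax => /orP[//|]; rewrite ltNge x0.
  rewrite ge0_integral_setU//; last 3 first.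
  + exact/measurable_EFinP/measurable_funTS.
  + by move=> x _; rewrite lee_fin /h; case: ifPn => // x0; rewrite mulr_ge0// ltW.
  + apply/disj_setPS => x [] /=; rewrite !in_itv/= le_min.
    move=> /andP[_ /andP[_ x0]] /andP[ax _].
    by move: x0; rewrite leNgt (le_lt_trans _ ax).
  rewrite (eq_integral (cst 1)); last first.
    move=> x; rewrite inE/= in_itv/= le_min /h => /andP[_ /andP[_]].
    by rewrite leNgt => /negbTE ->.
  have -> : \int[mu]_(x in `](Num.sqrt a), (Num.sqrt b)]) (h x)%:E =
      (Num.sqrt b ^+ 2 - Num.sqrt a ^+ 2)%:E.
    rewrite -(@integral_exprn 1%N) ?ler_wsqrtr//; apply: eq_integral => x.
    rewrite inE/= in_itv/= /h expr1 => /andP[ax _].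
    by rewrite (le_lt_trans _ ax).
  rewrite integral_cst//= lebesgue_measure_itv/= mul1e.
  have sqrt2 (c : R) : (Num.sqrt c ^+ 2 = Num.max c 0)%R.
    case: (leP c 0%R) => c0; last by rewrite sqr_sqrtr// ltW.
    by rewrite ler0_sqrtr// expr0n.
  rewrite !sqrt2 lte_fin.
  (* The nonpositive part contributes min(b,0) - min(a,0), the positive part max(b,0) - max(a,0); as
     min(c,0) + max(c,0) = c, the sum is b - a. *)
  have := addr_min_max a 0%R; have := addr_min_max b 0%R; rewrite !addr0.
  case: ltP => [_ Eb Ea|ba].
    by rewrite -!EFinD; congr EFin; lra.
  have -> : Num.min b 0%R = Num.min a 0%R.
    apply/le_anti; rewrite ba/= le_min !ge_min lexx orbT andbT.
    by rewrite ab.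
  move=> Eb Ea; rewrite add0e; congr EFin.
  by move: Eb Ea; set u := Num.min _ _ => Eb Ea; lra.
- by move=> y; rewrite patchE; case: ifPn.
apply: eq_integral => x _; rewrite !patchE !mem_setE !in_itv/= !andbT /phi /h.
by case: ifPn => x0; [rewrite exprn_gt0|rewrite (negbTE x0) mul0e].
Qed.

End lebesgue_substitution.

(** * Integrals of functions known only almost everywhere *)

Section ae_integral.
Context d (T : measurableType d) (R : realType).
Variable mu : {measure set T -> \bar R}.
Local Open Scope ereal_scope.
Import HBNNSimple.

(** Both integrals are suprema over simple functions. One below [f] is below [g] almost everywhere;
    one below [g], set to 0 on the null set, is below [f] and keeps its integral. *)
Let ge0_ae_measurable_integral (f g : T -> \bar R) :
  measurable_fun setT g -> (forall x, 0 <= f x) -> (forall x, 0 <= g x) ->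
  {ae mu, forall x, f x = g x} -> \int[mu]_x f x = \int[mu]_x g x.
Proof.
move=> mg f0 g0 [N [mN N0 fgN]].
have fg x : ~ N x -> f x = g x.
  by move=> Nx; apply: contrapT => fg; exact/Nx/fgN.
rewrite (ge0_integralTE _ f0).
apply/eqP; rewrite eq_le; apply/andP; split.
  apply/ge_ereal_sup => /= _ [h hf <-]; rewrite -integralT_nnsfun.
  apply: ae_ge0_le_integral => //.
  - by move=> x _; rewrite lee_fin.
  - exact/measurable_EFinP.
  - exists N; split => // x /= /not_implyP[_ hg]; apply: contrapT => Nx.
    by apply: hg; rewrite -fg.
rewrite (ge0_integralTE _ g0); apply/ge_ereal_sup => /= _ [h hg <-].
pose h' := proj_nnsfun h (measurableC mN).
have -> : sintegral mu h = sintegral mu h'.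
  rewrite -!integralT_nnsfun; apply: ge0_ae_eq_integral => //.
  - exact/measurable_EFinP.
  - exact/measurable_EFinP.
  - by move=> x _; rewrite lee_fin.
  - by move=> x _; rewrite lee_fin.
  - exists N; split => // x /= /not_implyP[_ hh]; apply: contrapT => Nx.
    by apply: hh; rewrite mindicE mem_set// mulr1.
apply: ereal_sup_ubound; exists h' => // x /=; rewrite mindicE.
have [|Nx] := boolP (x \in ~` N); last by rewrite mulr0.
by rewrite inE => Nx; rewrite mulr1 (fg _ Nx).
Qed.

(* Unlike [ae_eq_integral], [f] may be non-measurable. *)
Lemma ae_measurable_integral (D : set T) (f g : T -> \bar R) :
  measurable D -> measurable_fun D g ->
  {ae mu, forall x, D x -> f x = g x} ->
  \int[mu]_(x in D) f x = \int[mu]_(x in D) g x.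
Proof.
move=> mD mg fg; rewrite integral_mkcond [RHS]integral_mkcond.
have mgD : measurable_fun setT (g \_ D) by exact/(measurable_restrictT g mD).1.
have fgD : {ae mu, forall x, (f \_ D) x = (g \_ D) x}.
  apply: filterS fg => x /= fgx; rewrite !patchE.
  by case: ifPn => //; rewrite inE.
rewrite integralE [RHS]integralE; congr (_ - _).
- apply: ge0_ae_measurable_integral => //; first exact: measurable_funepos.
  by apply: filterS fgD => x; rewrite !funeposE => ->.
- apply: ge0_ae_measurable_integral => //; first exact: measurable_funeneg.
  by apply: filterS fgD => x; rewrite !funenegE => ->.
Qed.

End ae_integral.

(** * Gamma and Beta integrals *)

Section power.
Context (R : realType).
Implicit Types p q x c z : R.

(** The truncated power x_+^(p-1). Vanishing off the positive half-line, it encodes the domains of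
    the Beta, Gamma and fractional integrals. *)
Definition ppow p x : R := if 0 < x then x `^ (p - 1) else 0.

Lemma ppow_gt0 p x : 0 < x -> ppow p x = x `^ (p - 1).
Proof. by rewrite /ppow => ->. Qed.

Lemma ppow_le0 p x : x <= 0 -> ppow p x = 0.
Proof. by rewrite leNgt /ppow => /negbTE ->. Qed.

Lemma ppow_ge0 p x : 0 <= ppow p x.
Proof. by rewrite /ppow; case: ifP => // _; exact: powR_ge0. Qed.

Lemma ppow1 x : ppow 1 x = (0 < x)%R%:R.
Proof. by rewrite /ppow subrr powRr0; case: ltP. Qed.

Lemma ppowZ p c x : 0 < c -> ppow p (c * x) = c `^ (p - 1) * ppow p x.
Proof.
move=> c0; rewrite /ppow pmulr_rgt0//; case: ifPn => [x0|]; last by rewrite mulr0.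
by rewrite powRM// ltW.
Qed.

Lemma measurable_ppow p : measurable_fun [set: R] (ppow p).
Proof.
by apply: measurable_fun_ifT => //; exact: measurable_fun_ltr.
Qed.

Lemma measurableT_ppow d p (T : measurableType d) (f : T -> R) :
  measurable_fun setT f -> measurable_fun setT (fun t : T => ppow p (f t)).
Proof. by move=> mf; apply: (measurableT_comp (measurable_ppow p)). Qed.

End power.

Ltac measurable_real := repeat first
  [ exact: measurable_cst | exact: measurable_id
  | exact: measurable_fst | exact: measurable_snd
  | apply: measurableT_ppow
  | apply: measurable_funM | apply: measurable_funD | apply: measurable_funB
  | apply: measurable_funX | apply: measurable_funN
  | apply: (measurableT_comp (@measurable_expR _)) ].

Lemma tonelli d1 d2 (T1 : measurableType d1) (T2 : measurableType d2)
    (R : realType) (m1 : {sigma_finite_measure set T1 -> \bar R})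
    (m2 : {sigma_finite_measure set T2 -> \bar R}) (f : T1 -> T2 -> \bar R) :
  measurable_fun setT (fun z => f z.1 z.2) -> (forall x y, (0 <= f x y)%E) ->
  (\int[m1]_x \int[m2]_y f x y = \int[m2]_y \int[m1]_x f x y)%E.
Proof.
move=> mf f0.
by rewrite (fubini_tonelli (fun z => f z.1 z.2) mf (fun z => f0 z.1 z.2)).
Qed.

Lemma measurable_tonelli d1 d2 (T1 : measurableType d1)
    (T2 : measurableType d2) (R : realType)
    (m2 : {sigma_finite_measure set T2 -> \bar R}) (f : T1 -> T2 -> \bar R) :
  measurable_fun setT (fun z => f z.1 z.2) -> (forall x y, (0 <= f x y)%E) ->
  measurable_fun setT (fun x => (\int[m2]_y f x y)%E).
Proof.
move=> mf f0.
exact: (@measurable_fun_fubini_tonelli_F _ _ _ _ _ m2 (fun z => f z.1 z.2)).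
Qed.

Section gamma_beta.
Context (R : realType).
Notation mu := (@lebesgue_measure R).
Implicit Types p q x c z : R.
Local Open Scope ereal_scope.

(** Extended real values let Tonelli's theorem apply before any convergence is known. *)
Definition egamma p : \bar R := \int[mu]_x (ppow p x * expR (- x))%:E.

Definition ebeta p q : \bar R := \int[mu]_x (ppow p x * ppow q (1 - x))%:E.

Lemma fine_egamma p : Gamma p = fine (egamma p).
Proof.
rewrite /Gamma /Rintegral /egamma integral_mkcond; congr fine.
apply: eq_integral => x _; rewrite patchE /ppow.
case: ifPn; rewrite ?inE /= ?in_itv/= ?andbT; first by move=> ->.
by rewrite notin_setE/= in_itv/= andbT => /negP/negbTE ->; rewrite mul0r.
Qed.

(** For z > 0, scale x by z and use homogeneity; for z <= 0 one of the two factors always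
    vanishes. *)
Lemma integral_ppow_conv p q z :
  \int[mu]_x (ppow p x * ppow q (z - x))%:E = ebeta p q * (ppow (p + q) z)%:E.
Proof.
have [z0|z0] := leP z 0%R.
  rewrite (ppow_le0 _ z0) mule0 integral0_eq// => x _.
  have [x0|x0] := leP x 0%R; first by rewrite ppow_le0// mul0r.
  by rewrite [X in (_ * X)%R]ppow_le0 ?mulr0//; lra.
pose G x := (ppow p x * ppow q (z - x))%:E.
have mG : measurable_fun setT G by apply/measurable_EFinP; measurable_real.
have G0 x : 0 <= G x by rewrite lee_fin mulr_ge0// ppow_ge0.
rewrite -[LHS](ge0_integral_scale mG G0 z0) /G.
transitivity (\int[mu]_x ((ppow (p + q) z)%:E * (ppow p x * ppow q (1 - x))%:E)).
  apply: eq_integral => x _; rewrite -!EFinM; congr EFin.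
  have -> : (z - z * x = z * (1 - x))%R by ring.
  rewrite !ppowZ// (ppow_gt0 _ z0).
  have -> : (p + q - 1 = (p - 1) + (q - 1) + 1)%R by ring.
  rewrite !powRD ?(gt_eqF z0) ?implybT// powRr1 ?ltW//; ring.
rewrite ge0_integralZl//; first by rewrite muleC.
- by apply/measurable_EFinP; measurable_real.
- by move=> x _; rewrite lee_fin mulr_ge0// ppow_ge0.
- by rewrite lee_fin ppow_ge0.
Qed.

(** With z = x + y the product is the double integral of x^(p-1) (z-x)^(q-1) e^(-z); integrating in
    x first leaves a convolution of powers. *)
Lemma egammaM p q : egamma p * egamma q = ebeta p q * egamma (p + q).
Proof.
have g0 r x : (0 <= ppow r x * expR (- x))%R by rewrite mulr_ge0// ?ppow_ge0 ?expR_ge0.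
have mg r : measurable_fun [set: R] (fun x => (ppow r x * expR (- x))%:E).
  by apply/measurable_EFinP; measurable_real.
transitivity (\int[mu]_x \int[mu]_z
    (ppow p x * ppow q (z - x) * expR (- z))%:E).
  rewrite muleC -ge0_integralZl//; last 3 first.
  - exact: mg.
  - by move=> x _; rewrite lee_fin.
  - by apply: integral_ge0 => x _; rewrite lee_fin.
  apply: eq_integral => x _; rewrite muleC -ge0_integralZl//; last 3 first.
  - exact: mg.
  - by move=> y _; rewrite lee_fin.
  - by rewrite lee_fin.
  rewrite -(@ge0_integral_shift _ _ _ _ x)/=.
  - apply: eq_integral => y _; rewrite -EFinM addrK; congr EFin.
    by rewrite opprD expRD; ring.
  - by apply/measurable_EFinP; measurable_real.
  - by move=> z; rewrite lee_fin !mulr_ge0// ?ppow_ge0 ?expR_ge0.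
rewrite [LHS]tonelli; last 2 first.
- by apply/measurable_EFinP; measurable_real.
- by move=> x z; rewrite lee_fin !mulr_ge0// ?ppow_ge0 ?expR_ge0.
have b0 : 0 <= ebeta p q.
  by apply: integral_ge0 => x _; rewrite lee_fin mulr_ge0// ppow_ge0.
rewrite -ge0_integralZl//; last 2 first.
- exact: mg.
- by move=> x _; rewrite lee_fin.
apply: eq_integral => z _; rewrite EFinM muleA -integral_ppow_conv.
rewrite [RHS]muleC -ge0_integralZl//.
- by apply: eq_integral => x _; rewrite -EFinM mulrC.
- by apply/measurable_EFinP; measurable_real.
- by move=> x _; rewrite lee_fin mulr_ge0// ppow_ge0.
Qed.

Let integral_gt0 (f : R -> \bar R) (a b : R) : (a < b)%R ->
  measurable_fun setT f -> (forall x, 0 <= f x) ->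
  (forall x, (a < x < b)%R -> 0 < f x) -> 0 < \int[mu]_x f x.
Proof.
move=> ab mf f0 fab; rewrite lt0e integral_ge0 ?andbT; last by move=> x _; exact: f0.
apply/negP => /eqP intf0.
have : \int[mu]_x `|f x| = 0.
  by rewrite -[RHS]intf0; apply: eq_integral => x _; rewrite gee0_abs.
move=> /(ae_eq_integral_abs mu measurableT mf) [N [mN N0 fN]].
have : mu `]a, b[ <= 0.
  rewrite -N0 le_measure ?inE//= => x /=; rewrite in_itv/= => xab.
  by apply: fN => /= /(_ I) fx0; move: (fab _ xab); rewrite fx0 ltxx.
by rewrite /= lebesgue_measure_itv/= lte_fin ab leNgt -EFinD lte_fin subr_gt0 ab.
Qed.

Lemma egamma_gt0 p : 0 < egamma p.
Proof.
apply: (@integral_gt0 _ 0%R 1%R) => //.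
- by apply/measurable_EFinP; measurable_real.
- by move=> x; rewrite lee_fin mulr_ge0// ?ppow_ge0 ?expR_ge0.
- by move=> x /andP[x0 _]; rewrite lte_fin mulr_gt0 ?expR_gt0// ppow_gt0// powR_gt0.
Qed.

Lemma ebeta_gt0 p q : 0 < ebeta p q.
Proof.
apply: (@integral_gt0 _ 0%R 1%R) => //.
- by apply/measurable_EFinP; measurable_real.
- by move=> x; rewrite lee_fin mulr_ge0// ppow_ge0.
- move=> x /andP[x0 x1].
  by rewrite lte_fin mulr_gt0// ppow_gt0 ?powR_gt0// subr_gt0.
Qed.

(** Since [ebeta p q] is positive, an infinite [egamma (p + q)] would make the product of the two
    finite factors infinite. Finiteness thus spreads from 1/2 to all positive half-integers. *)
Lemma egammaD_fin_num p q : egamma p \is a fin_num -> egamma q \is a fin_num ->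
  egamma (p + q) \is a fin_num.
Proof.
move=> pfin qfin; have := fin_numM pfin qfin.
rewrite egammaM; apply: contraTT.
have := egamma_gt0 (p + q); case: (egamma (p + q)) => //= _ _.
by rewrite gt0_muley ?ebeta_gt0.
Qed.

(** The substitution x = s^2 gives twice the Gauss integral over the half-line. *)
Lemma egamma_half : egamma (1 / 2) = (Num.sqrt pi)%:E.
Proof.
pose G x : \bar R := (ppow (1 / 2) x * expR (- x))%:E.
have mG : measurable_fun setT G by apply/measurable_EFinP; measurable_real.
have G0 x : 0 <= G x by rewrite lee_fin mulr_ge0// ?ppow_ge0 ?expR_ge0.
have -> : egamma (1 / 2) = \int[mu]_(x in `]0%R, +oo[) G x.
  rewrite [RHS]integral_mkcond; apply: eq_integral => x _.
  rewrite patchE; case: ifPn => //; rewrite notin_setE/= in_itv/= andbT.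
  by move=> /negP; rewrite -leNgt /G => x0; rewrite ppow_le0// mul0r.
rewrite -ge0_integral_sqr//.
transitivity (\int[mu]_(x in `]0%R, +oo[) (2%:E * (gauss_fun x)%:E)).
  apply: eq_integral => x; rewrite inE/= in_itv/= andbT => x0.
  rewrite /G -!EFinM; congr EFin; rewrite /gauss_fun.
  rewrite ppow_gt0 ?exprn_gt0// (_ : 1 / 2 - 1 = 2^-1 * (-1))%R; last by field.
  rewrite powRrM powR12_sqrt ?sqr_ge0// sqrtr_sqr gtr0_norm// powR_inv1 ?ltW//.
  by field; rewrite gt_eqF.
rewrite ge0_integralZl//; last 2 first.
- by apply/measurable_EFinP/measurable_funTS; exact: measurable_gauss_fun.
- by move=> x _; rewrite lee_fin gauss_fun_ge0.
rewrite integral_itv_obnd_cbnd ?integral0y_gauss; last first.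
  by apply/measurable_EFinP/measurable_funTS; exact: measurable_gauss_fun.
by rewrite -EFinM; congr EFin; rewrite mulrC divfK.
Qed.

Lemma egamma_halfn n : egamma (n.+1%:R / 2) \is a fin_num.
Proof.
elim: n => [|n IHn]; first by rewrite egamma_half.
rewrite -addn1 natrD mulrDl; apply: egammaD_fin_num; first exact: IHn.
by rewrite egamma_half.
Qed.

Lemma EFin_Gamma n : (Gamma (n.+1%:R / 2 : R))%:E = egamma (n.+1%:R / 2).
Proof. by rewrite fine_egamma fineK// egamma_halfn. Qed.

Lemma Gamma_half : Gamma (1 / 2 : R) = Num.sqrt pi.
Proof. by rewrite fine_egamma egamma_half. Qed.

Lemma Gamma_halfn_gt0 n : (0 < Gamma (n.+1%:R / 2 : R))%R.
Proof. by rewrite -lte_fin EFin_Gamma egamma_gt0. Qed.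

Lemma ebeta_halfn m n : ebeta (m.+1%:R / 2) (n.+1%:R / 2) =
  (Gamma (m.+1%:R / 2) * Gamma (n.+1%:R / 2) / Gamma ((m + n).+2%:R / 2))%:E.
Proof.
have := egammaM (m.+1%:R / 2) (n.+1%:R / 2).
rewrite -mulrDl -natrD addSn addnS -!EFin_Gamma -EFinM.
have := Gamma_halfn_gt0 (m + n).+1.
(* An infinite Beta value is excluded: the product of the two Gamma values is finite. *)
case: (ebeta _ _) (ebeta_gt0 (m.+1%:R / 2) (n.+1%:R / 2)) => // [b _|_] g0.
  by rewrite -EFinM => -[->]; rewrite mulfK// gt_eqF.
by rewrite gt0_mulye.
Qed.

Lemma integral_ppow_conv_halfn m n z :
  \int[mu]_x (ppow (m.+1%:R / 2) x * ppow (n.+1%:R / 2) (z - x))%:E =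
  (Gamma (m.+1%:R / 2) * Gamma (n.+1%:R / 2) / Gamma ((m + n).+2%:R / 2) *
   ppow ((m + n).+2%:R / 2) z)%:E.
Proof.
by rewrite integral_ppow_conv ebeta_halfn -mulrDl -natrD addSn addnS -EFinM.
Qed.

End gamma_beta.

(** * Lebesgue measure on R^k *)

Section lebesgue_tuple.
Context (R : realType).
Notation mu := (@lebesgue_measure R).
Local Open Scope ereal_scope.

Lemma ge0_integral_lebesgue_cons k (F : k.+1.-tuple R -> \bar R) :
  measurable_fun setT F -> (forall y, 0 <= F y) ->
  \int[lebesgue_tuple R k.+1]_y F y =
  \int[mu]_x \int[lebesgue_tuple R k]_y F (cons_pair (x, y)).
Proof.
move=> mF F0.
have mFc : measurable_fun setT (fun z => F (@cons_pair R k z)).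
  by apply: measurableT_comp mF _; exact: measurable_cons_pair.
transitivity (\int[mu \x lebesgue_tuple R k]_z F (cons_pair z)).
  rewrite -(@ge0_change_of_variables _ _ _ _ R (mu \x lebesgue_tuple R k)
    (lebesgue_tuple R k.+1) (@cons_pair R k) (fun=> 1%R)).
  - by apply: eq_integral => z _; rewrite mule1.
  - exact: measurable_cons_pair.
  - exact: measurable_cst.
  - by move=> _; exact: ler01.
  - move=> A mA; rewrite integral_cst ?mul1e//.
    by rewrite -[X in measurable X]setTI; exact: measurable_cons_pair.
  - exact: mF.
  - exact: F0.
exact: (@fubini_tonelli1 _ _ _ _ R mu (lebesgue_tuple R k)
  (fun z => F (cons_pair z)) mFc (fun z => F0 _)).
Qed.

Lemma integral_lebesgue_tuple0 (F : 0.-tuple R -> \bar R) :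
  measurable_fun setT F -> \int[lebesgue_tuple R 0]_y F y = F [tuple].
Proof.
move=> mF; transitivity (\int[\d_ [tuple]]_y F y) => //.
by rewrite integral_dirac// diracE mem_set// mul1e.
Qed.

Definition sqnorm k (y : k.-tuple R) : R := (\sum_(i < k) tnth y i ^+ 2)%R.

Definition linform k (e : 'I_k -> R) (y : k.-tuple R) : R :=
  (\sum_(i < k) e i * tnth y i)%R.

Lemma l2normE k (y : k.-tuple R) : l2norm (tnth y) = Num.sqrt (sqnorm y).
Proof. by []. Qed.

Lemma sqnorm_ge0 k (y : k.-tuple R) : (0 <= sqnorm y)%R.
Proof. by apply: sumr_ge0 => i _; exact: sqr_ge0. Qed.

Lemma sqnorm_cons k x (y : k.-tuple R) :
  sqnorm (cons_pair (x, y)) = (x ^+ 2 + sqnorm y)%R.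
Proof.
rewrite /sqnorm big_ord_recl; congr +%R.
by apply: eq_bigr => i _; rewrite /cons_pair tnthS.
Qed.

Lemma linform_cons k (e : 'I_k.+1 -> R) x (y : k.-tuple R) :
  linform e (cons_pair (x, y)) =
  (e ord0 * x + linform (e \o lift ord0) y)%R.
Proof.
rewrite /linform big_ord_recl; congr +%R.
by apply: eq_bigr => i _; rewrite /cons_pair tnthS.
Qed.

Lemma measurable_sqnorm k : measurable_fun setT (@sqnorm k).
Proof.
by apply: measurable_sum => i; apply: measurable_funX; exact: measurable_tnth.
Qed.

Lemma measurable_linform k (e : 'I_k -> R) : measurable_fun setT (linform e).
Proof.
apply: measurable_sum => i; apply: measurable_funM => //.
exact: measurable_tnth.
Qed.

(** The map x -> x^2 + b covers ]b, +oo[ twice, each branch with density (c - b)^(-1/2) / 2. *)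
Lemma ge0_integral_sqrD (G : R -> \bar R) (b : R) :
  measurable_fun setT G -> (forall y, 0 <= G y) ->
  \int[mu]_x G (x ^+ 2 + b)%R = \int[mu]_c (G c * (ppow (1 / 2) (c - b))%:E).
Proof.
move=> mG G0.
have mGb : measurable_fun [set: R] (fun x => G (x ^+ 2 + b)%R).
  by apply: (measurableT_comp mG); measurable_real.
transitivity (2%:E * \int[mu]_(x in `]0%R, +oo[) G (x ^+ 2 + b)%R).
  rewrite -(setUv `]0%R, +oo[%classic) ge0_integral_setU//; last 3 first.
  - exact: measurableC.
  - by rewrite setUv.
  - by rewrite disj_set2E setICr.
  rewrite setCitvr.
  have := @ge0_integration_by_substitution0 R _ mGb (fun x => G0 _).
  under [X in _ = X -> _]eq_integral do rewrite sqrrN.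
  move=> <-; rewrite integral_itv_obnd_cbnd; last exact: measurable_funTS.
  by rewrite (_ : 2%:E = 1 + 1)%E// ge0_muleDl// mul1e.
rewrite -ge0_integralZl//; last exact: measurable_funTS.
pose H y := G (y + b)%R * (ppow (1 / 2) y)%:E.
have mH : measurable_fun setT H.
  apply: emeasurable_funM; first by apply: (measurableT_comp mG); measurable_real.
  by apply/measurable_EFinP; measurable_real.
have H0 y : 0 <= H y by rewrite mule_ge0// lee_fin ppow_ge0.
transitivity (\int[mu]_(x in `]0%R, +oo[) (H (x ^+ 2)%R * (2 * x)%:E)).
  apply: eq_integral => x; rewrite inE/= in_itv/= andbT => x0.
  rewrite /H.
  rewrite -muleA.
  rewrite -EFinM.
  rewrite muleC.
  congr (G _ * _%:E).
  rewrite ppow_gt0 ?exprn_gt0// (_ : 1 / 2 - 1 = 2^-1 * (-1))%R; last by field.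
  rewrite powRrM powR12_sqrt ?sqr_ge0// sqrtr_sqr gtr0_norm// powR_inv1 ?ltW//.
  by field; rewrite gt_eqF.
rewrite (ge0_integral_sqr mH H0).
transitivity (\int[mu]_y H y).
  rewrite integral_mkcond; apply: eq_integral => x _.
  rewrite patchE; case: ifPn => //; rewrite notin_setE/= in_itv/= andbT.
  by move=> /negP; rewrite -leNgt /H => x0; rewrite ppow_le0// mule0.
rewrite -[RHS](@ge0_integral_shift _ _ _ _ b)/=.
- by apply: eq_integral => x _; rewrite addrK.
- apply: emeasurable_funM => //.
  by apply/measurable_EFinP; measurable_real.
- by move=> y; rewrite mule_ge0// lee_fin ppow_ge0.
Qed.

(** Half the area of the unit sphere of R^d, that is, d/2 times the volume of the unit ball. *)
Definition ball_const d : R := pi `^ (d%:R / 2) / Gamma (d%:R / 2).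

Lemma ball_const_gt0 d : (0 < ball_const d.+1)%R.
Proof. by rewrite divr_gt0 ?Gamma_halfn_gt0// powR_gt0// pi_gt0. Qed.

(** By induction: one more coordinate convolves the density of |y|^2 with r_+^(-1/2), raising the
    exponent by 1/2; the Beta constant and Gamma(1/2) = sqrt(pi) update the factor. *)
Lemma ge0_integral_sqnorm d (G : R -> \bar R) :
  measurable_fun setT G -> (forall y, 0 <= G y) ->
  \int[lebesgue_tuple R d.+1]_y G (sqnorm y) =
  (ball_const d.+1)%:E * \int[mu]_b (G b * (ppow (d.+1%:R / 2) b)%:E).
Proof.
have mGs k (F : R -> \bar R) : measurable_fun setT F ->
    measurable_fun setT (fun y : k.-tuple R => F (sqnorm y)).
  by move=> mF; exact: measurableT_comp mF (@measurable_sqnorm k).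
elim: d G => [|d IHd] G mG G0;
  (rewrite ge0_integral_lebesgue_cons; [|exact: mGs|by move=> y; exact: G0]).
  transitivity (\int[mu]_x G (x ^+ 2 + 0)%R).
    apply: eq_integral => x _; rewrite integral_lebesgue_tuple0.
      by rewrite sqnorm_cons /sqnorm big_ord0.
    apply: (measurableT_comp (mGs 1%N _ mG)).
    by apply: (measurableT_comp (@measurable_cons_pair R 0)).
  rewrite ge0_integral_sqrD// /ball_const Gamma_half.
  rewrite mul1r powR12_sqrt ?pi_ge0// divff ?mul1e; last first.
    by rewrite gt_eqF// sqrtr_gt0 pi_gt0.
  by apply: eq_integral => x _; rewrite subr0.
have C0 : 0 <= (ball_const d.+1)%:E by rewrite lee_fin ltW// ball_const_gt0.
transitivity (\int[mu]_x ((ball_const d.+1)%:E *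
    \int[mu]_b (G (x ^+ 2 + b)%R * (ppow (d.+1%:R / 2) b)%:E))).
  apply: eq_integral => x _; under eq_integral do rewrite sqnorm_cons.
  rewrite (IHd (fun b => G (x ^+ 2 + b)%R))//.
  by apply: (measurableT_comp mG); measurable_real.
have mGb : measurable_fun setT (fun z : R * R =>
    G (z.1 ^+ 2 + z.2)%R * (ppow (d.+1%:R / 2) z.2)%:E).
  apply: emeasurable_funM; first by apply: (measurableT_comp mG); measurable_real.
  by apply/measurable_EFinP; measurable_real.
have p0 p x : 0 <= (ppow p x : R)%:E by rewrite lee_fin ppow_ge0.
rewrite ge0_integralZl; last 4 first.
- by [].
- by apply: measurable_tonelli => [|x b]; [exact: mGb|rewrite mule_ge0].
- by move=> x _; apply: integral_ge0 => b _; rewrite mule_ge0.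
- exact: C0.
rewrite [X in _ * X]tonelli; last 2 first.
- exact: mGb.
- by move=> x b; rewrite mule_ge0.
(* The new coordinate x is replaced by c = x^2 + b, the full squared norm, so that [G] leaves the
   integral in b. *)
transitivity ((ball_const d.+1)%:E * \int[mu]_b \int[mu]_c
    (G c * (ppow (d.+1%:R / 2) b * ppow (1 / 2) (c - b))%:E)).
  apply: (congr1 (mule _)); apply: eq_integral => b _.
  rewrite ge0_integralZr//; last first.
    by apply: (measurableT_comp mG); measurable_real.
  rewrite ge0_integral_sqrD// -ge0_integralZr//.
  - by apply: eq_integral => c _; rewrite -muleA -EFinM mulrC.
  - by apply: emeasurable_funM => //; apply/measurable_EFinP; measurable_real.
  - by move=> c _; rewrite mule_ge0.
rewrite [X in _ * X]tonelli; last 2 first.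
- apply: emeasurable_funM; first exact: (measurableT_comp mG).
  by apply/measurable_EFinP; measurable_real.
- by move=> b c; rewrite mule_ge0// lee_fin mulr_ge0 ?ppow_ge0.
transitivity ((ball_const d.+1)%:E * \int[mu]_c
    ((Gamma (d.+1%:R / 2) * Gamma (1 / 2) / Gamma (d.+2%:R / 2))%:E *
     (G c * (ppow (d.+2%:R / 2) c)%:E))).
  apply: (congr1 (mule _)); apply: eq_integral => c _.
  rewrite ge0_integralZl//; last 2 first.
  - by apply/measurable_EFinP; measurable_real.
  - by move=> x _; rewrite lee_fin mulr_ge0 ?ppow_ge0.
  by rewrite (integral_ppow_conv_halfn d 0) addn0 EFinM muleCA.
rewrite ge0_integralZl; last 4 first.
- by [].
- apply: emeasurable_funM => //; apply/measurable_EFinP; measurable_real.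
- by move=> x _; rewrite mule_ge0.
- rewrite lee_fin Gamma_half; apply: divr_ge0; [apply: mulr_ge0|].
  + exact: ltW (Gamma_halfn_gt0 R d).
  + exact: sqrtr_ge0.
  + exact: ltW (Gamma_halfn_gt0 R d.+1).
rewrite muleA -EFinM Gamma_half; apply: (congr1 (fun c => c%:E * _)).
rewrite /ball_const.
have -> : (pi `^ (d.+2%:R / 2) = pi `^ (d.+1%:R / 2) * Num.sqrt pi :> R)%R.
  rewrite -powR12_sqrt ?pi_ge0// -powRD ?(gt_eqF (pi_gt0 _)) ?implybT//.
  by rewrite -[in LHS]natr1 mulrDl mul1r.
move: (Gamma_halfn_gt0 R d) (Gamma_halfn_gt0 R d.+1).
move: (Gamma _) (Gamma _) => g1 g2 g10 g20.
by field; rewrite !gt_eqF.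
Qed.

(** The rotation to u = c x + s y, v = c y - s x is done by two one-dimensional affine
    substitutions: x by u at fixed y, then y by v = (y - s u) / c at fixed u. Their factors c and
    1/c cancel, which is why c > 0 is assumed. *)
Lemma ge0_integral_rotation_pos (K : R * R -> \bar R) (c s : R) :
  (0 < c)%R -> (c ^+ 2 + s ^+ 2 = 1)%R ->
  measurable_fun setT K -> (forall z, 0 <= K z) ->
  \int[mu]_x \int[mu]_y K (c * x + s * y, x ^+ 2 + y ^+ 2)%R =
  \int[mu]_x \int[mu]_y K (x, x ^+ 2 + y ^+ 2)%R.
Proof.
move=> c0 cs1 mK K0; rewrite [LHS]tonelli; last 2 first.
- by apply: (measurableT_comp mK); apply: measurable_fun_pair; measurable_real.
- by move=> x y; exact: K0.
pose L (u y : R) := K (u, u ^+ 2 + (c^-1 * y + - (c^-1 * s * u)) ^+ 2)%R * c^-1%:E.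
have L0 u y : 0 <= L u y by rewrite mule_ge0// lee_fin invr_ge0 ltW.
have mL : measurable_fun setT (fun z => L z.1 z.2).
  apply: emeasurable_funM => //.
  by apply: (measurableT_comp mK); apply: measurable_fun_pair; measurable_real.
transitivity (\int[mu]_y \int[mu]_u L u y).
  apply: eq_integral => y _.
  rewrite -[RHS](@ge0_integral_affine _ _ _ _ c (s * y)%R)//; last first.
    exact: measurableT_comp mL (measurable_pair2 _).
  apply: eq_integral => x _; rewrite /L -muleA -EFinM mulVf ?gt_eqF// mule1.
  have -> : (c^-1 * y + - (c^-1 * s * (c * x + s * y)) = c * y - s * x)%R.
    transitivity (c^-1 * ((c ^+ 2 + s ^+ 2) * y - s * (c * x + s * y)))%R.
      by rewrite cs1; ring.
    by field; rewrite gt_eqF.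
  by congr (K (_, _)); rewrite -[LHS]mul1r -cs1; ring.
rewrite -(tonelli mu mu mL L0); apply: eq_integral => u _; rewrite /L.
rewrite -[RHS](@ge0_integral_affine _ _ _ _ c^-1 (- (c^-1 * s * u))%R)// ?invr_gt0//.
by apply: (measurableT_comp mK); apply: measurable_fun_pair; measurable_real.
Qed.

End lebesgue_tuple.

(** * Rotation invariance and linear forms *)

Section rotation.
Context (R : realType).
Notation mu := (@lebesgue_measure R).
Local Open Scope ereal_scope.

(** The other signs reduce to c > 0 or to a coordinate swap: x -> -x changes the sign of c, and c =
    0 forces s = 1 or s = -1. *)
Lemma ge0_integral_rotation (K : R * R -> \bar R) (c s : R) :
  (c ^+ 2 + s ^+ 2 = 1)%R -> measurable_fun setT K -> (forall z, 0 <= K z) ->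
  \int[mu]_x \int[mu]_y K (c * x + s * y, x ^+ 2 + y ^+ 2)%R =
  \int[mu]_x \int[mu]_y K (x, x ^+ 2 + y ^+ 2)%R.
Proof.
move=> cs1 mK K0.
have mKf d (T : measurableType d) (f g : T -> R) : measurable_fun setT f ->
    measurable_fun setT g -> measurable_fun setT (fun t => K (f t, g t)).
  by move=> mf mg; apply: (measurableT_comp mK); exact: measurable_fun_pair.
have mint (f g : R -> R -> R) :
    measurable_fun setT (fun z => f z.1 z.2) ->
    measurable_fun setT (fun z => g z.1 z.2) ->
    measurable_fun [set: R] (fun x => \int[mu]_y K (f x y, g x y)).
  move=> mf mg; apply: measurable_tonelli => [|x y]; last exact: K0.
  exact: mKf.
have [c0|c0|c0] := ltgtP c 0%R; last first.
- have mK1 s' : measurable_fun setT (fun z : R * R => K (s' * z.2, z.1 ^+ 2 + z.2 ^+ 2)%R).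
    by apply: mKf; measurable_real.
  transitivity (\int[mu]_y \int[mu]_x K (s * y, y ^+ 2 + x ^+ 2)%R).
    rewrite [LHS]tonelli; last 2 first.
    - by apply: mKf; measurable_real.
    - by move=> x y; exact: K0.
    apply: eq_integral => y _; apply: eq_integral => x _.
    by rewrite c0 mul0r add0r addrC.
  have : (s ^+ 2 == 1)%R by rewrite -cs1 c0 expr0n add0r.
  rewrite sqrf_eq1 => /orP[] /eqP ->.
    by apply: eq_integral => y _; apply: eq_integral => x _; rewrite mul1r.
  rewrite -[RHS]ge0_integral_opp.
  + by apply: eq_integral => y _; apply: eq_integral => x _; rewrite mulN1r sqrrN.
  + by apply: mint; measurable_real.
  + by move=> y; apply: integral_ge0 => x _; exact: K0.
- exact: ge0_integral_rotation_pos.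
- rewrite -[LHS]ge0_integral_opp.
  + have Nc0 : (0 < - c)%R by rewrite oppr_gt0.
    have Ncs1 : ((- c) ^+ 2 + s ^+ 2 = 1)%R by rewrite sqrrN.
    rewrite -(ge0_integral_rotation_pos Nc0 Ncs1 mK K0).
    by apply: eq_integral => x _; apply: eq_integral => y _; rewrite sqrrN mulrN mulNr.
  + by apply: mint; measurable_real.
  + by move=> y; apply: integral_ge0 => x _; exact: K0.
Qed.

Lemma l2norm_recl k (e : 'I_k.+1 -> R) :
  (l2norm e = Num.sqrt (e ord0 ^+ 2 + l2norm (e \o lift ord0) ^+ 2))%R.
Proof.
rewrite /l2norm sqr_sqrtr; last by apply: sumr_ge0 => i _; exact: sqr_ge0.
by rewrite big_ord_recl.
Qed.

Let measurable_lin_sqnorm k (e : 'I_k -> R) (G : R * R -> \bar R) d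
    (T : measurableType d) (f g : T -> R) (h : T -> k.-tuple R) :
  measurable_fun setT G -> measurable_fun setT f -> measurable_fun setT g ->
  measurable_fun setT h ->
  measurable_fun setT (fun t => G (f t + linform e (h t), g t + sqnorm (h t))%R).
Proof.
move=> mG mf mg mh; apply: (measurableT_comp mG); apply: measurable_fun_pair.
- apply: measurable_funD => //.
  by apply: measurableT_comp mh; exact: measurable_linform.
- apply: measurable_funD => //.
  by apply: measurableT_comp mh; exact: measurable_sqnorm.
Qed.

Let measurable_lin_sqnorm0 k (e : 'I_k -> R) (G : R * R -> \bar R) :
  measurable_fun setT G ->
  measurable_fun setT (fun y => G (linform e y, sqnorm y)).
Proof.
move=> mG; apply: (measurableT_comp mG); apply: measurable_fun_pair.
- exact: measurable_linform.
- exact: measurable_sqnorm.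
Qed.

(* By rotation invariance in the plane of the first two coordinates, the
   coefficients of the linear form are absorbed one after the other. *)
Lemma ge0_integral_linform_sqnorm k (e : 'I_k.+1 -> R) (G : R * R -> \bar R) :
  measurable_fun setT G -> (forall z, 0 <= G z) ->
  \int[lebesgue_tuple R k.+1]_y G (linform e y, sqnorm y) =
  \int[mu]_x \int[lebesgue_tuple R k]_y
    G (l2norm e * x, x ^+ 2 + sqnorm y)%R.
Proof.
elim: k e G => [|k IHk] e G mG G0.
  rewrite ge0_integral_lebesgue_cons; last 2 first.
  - exact: measurable_lin_sqnorm0.
  - by move=> y; exact: G0.
  have ne : l2norm e = `|e ord0|%R.
    by rewrite /l2norm big_ord1 sqrtr_sqr.
  transitivity (\int[mu]_x G (e ord0 * x, x ^+ 2)%R).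
    apply: eq_integral => x _; rewrite integral_lebesgue_tuple0; last first.
      apply: (measurableT_comp (measurable_lin_sqnorm0 e mG)).
      by apply: (measurableT_comp (@measurable_cons_pair R 0)).
    by rewrite linform_cons sqnorm_cons /linform /sqnorm !big_ord0 !addr0.
  transitivity (\int[mu]_x G (l2norm e * x, x ^+ 2)%R); last first.
    apply: eq_integral => x _; rewrite integral_lebesgue_tuple0; last first.
      apply: (measurableT_comp mG); apply: measurable_fun_pair => //.
      by apply: measurable_funD => //; exact: measurable_sqnorm.
    by rewrite /sqnorm big_ord0 addr0.
  have mGe a : measurable_fun setT (fun x : R => G (a * x, x ^+ 2)%R).
    by apply: (measurableT_comp mG); apply: measurable_fun_pair; measurable_real.
  rewrite ne; have [e0|e0] := leP 0%R (e ord0).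
    by rewrite ger0_norm.
  rewrite ltr0_norm// -[RHS](ge0_integral_opp (mGe _) (fun=> G0 _)).
  by apply: eq_integral => x _; rewrite mulrNN sqrrN.
rewrite ge0_integral_lebesgue_cons; last 2 first.
- exact: measurable_lin_sqnorm0.
- by move=> y; exact: G0.
set rho := l2norm (e \o lift ord0); set tau := l2norm e.
have tauE : (tau ^+ 2 = e ord0 ^+ 2 + rho ^+ 2)%R.
  by rewrite /tau l2norm_recl sqr_sqrtr// addr_ge0// sqr_ge0.
transitivity (\int[mu]_x \int[mu]_w \int[lebesgue_tuple R k]_y
    G (e ord0 * x + rho * w, (x ^+ 2 + w ^+ 2) + sqnorm y)%R).
  apply: eq_integral => x _.
  under eq_integral do rewrite linform_cons sqnorm_cons.
  rewrite (IHk (e \o lift ord0) (fun z => G (e ord0 * x + z.1, x ^+ 2 + z.2)%R)).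
  - by apply: eq_integral => w _; apply: eq_integral => y _; rewrite /= addrA.
  - by apply: (measurableT_comp mG); apply: measurable_fun_pair; measurable_real.
  - by move=> z; exact: G0.
transitivity (\int[mu]_x \int[mu]_w \int[lebesgue_tuple R k]_y
    G (tau * x, (x ^+ 2 + w ^+ 2) + sqnorm y)%R); last first.
  apply: eq_integral => x _; rewrite ge0_integral_lebesgue_cons; last 2 first.
  - apply: (measurableT_comp mG); apply: measurable_fun_pair => //.
    by apply: measurable_funD => //; exact: measurable_sqnorm.
  - by move=> y; exact: G0.
  apply: eq_integral => w _; apply: eq_integral => y _.
  by rewrite sqnorm_cons addrA.
(* If [tau] is 0 there is no angle to rotate by, but the linear form vanishes. *)
have [tau0|tau0] := eqVneq tau 0%R.
  have [e0 rho0] : e ord0 = 0%R /\ rho = 0%R.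
    have : (e ord0 ^+ 2 + rho ^+ 2 == 0)%R by rewrite -tauE tau0 expr0n.
    by rewrite paddr_eq0 ?sqr_ge0// !sqrf_eq0 => /andP[/eqP -> /eqP ->].
  apply: eq_integral => x _; apply: eq_integral => w _; apply: eq_integral => y _.
  by rewrite e0 rho0 tau0 !mul0r addr0.
pose K (z : R * R) := \int[lebesgue_tuple R k]_y G (tau * z.1, z.2 + sqnorm y)%R.
have mK : measurable_fun setT K.
  apply: measurable_tonelli => [|x y]; last exact: G0.
  apply: (measurableT_comp mG); apply: measurable_fun_pair.
    apply: measurable_funM => //; apply: measurableT_comp measurable_fst.
    exact: measurable_fst.
  apply: measurable_funD.
    by apply: measurableT_comp measurable_fst; exact: measurable_snd.
  by apply: measurableT_comp measurable_snd; exact: measurable_sqnorm.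
have K0 z : 0 <= K z by apply: integral_ge0 => y _; exact: G0.
(* Cosine and sine of the rotation that carries e_0 x + rho w to tau x. *)
have cs1 : ((e ord0 / tau) ^+ 2 + (rho / tau) ^+ 2 = 1)%R.
  by rewrite !expr_div_n -mulrDl -tauE divff// expf_eq0.
rewrite -[RHS](ge0_integral_rotation cs1 mK K0).
apply: eq_integral => x _; apply: eq_integral => w _; apply: eq_integral => y _.
by congr (G (_, _)) => /=; field.
Qed.

End rotation.

(** * Surface measure of the sphere *)

Section sphere.
Context (R : realType).
Notation mu := (@lebesgue_measure R).
Local Open Scope ereal_scope.

(** After x = s^2 the half-integer power becomes the monomial 2 s^k. *)
Lemma integral_ppow_le1 k :
  \int[mu]_x (ppow (k.+1%:R / 2) x * (x <= 1)%R%:R)%:E = (2 / k.+1%:R)%:E.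
Proof.
pose G (x : R) : \bar R := (ppow (k.+1%:R / 2) x * (x <= 1)%R%:R)%:E.
have mG : measurable_fun setT G.
  apply/measurable_EFinP; apply: measurable_funM; first exact: measurable_ppow.
  rewrite (_ : (fun _ => _) = \1_`]-oo, 1%R]); last first.
    by apply/funext => x; rewrite indicE mem_setE in_itv.
  exact: measurable_indic.
have G0 x : 0 <= G x by rewrite lee_fin mulr_ge0// ppow_ge0.
transitivity (\int[mu]_(x in `]0%R, +oo[) G x).
  rewrite [RHS]integral_mkcond; apply: eq_integral => x _.
  rewrite patchE; case: ifPn => //; rewrite notin_setE/= in_itv/= andbT.
  by move=> /negP; rewrite -leNgt => x0; rewrite ppow_le0// mul0r.
rewrite -(ge0_integral_sqr mG G0).
transitivity (\int[mu]_(x in `]0%R, 1%R]) ((2 / k.+1%:R)%:E * (k.+1%:R * x ^+ k)%:E)).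
  rewrite [LHS]integral_mkcond [RHS]integral_mkcond; apply: eq_integral => x _.
  rewrite !patchE !mem_setE !in_itv/= andbT.
  case: ifPn => x0 //=; rewrite /G.
  have -> : (x ^+ 2 <= 1)%R = (x <= 1)%R by rewrite expr_le1// ltW.
  case: ifPn => x1; last by rewrite mulr0 mul0e.
  rewrite mulr1 ppow_gt0 ?exprn_gt0// -!EFinM; congr EFin.
  rewrite -[X in (X `^ _ * _)%R]powR_mulrn ?ltW// -powRrM.
  have -> : (2 * (k.+1%:R / 2 - 1) = k%:R - 1 :> R)%R.
    by rewrite -natr1; field.
  have -> : (x `^ (k%:R - 1) * (2 * x) = 2 * (x `^ (k%:R - 1) * x `^ 1))%R.
    by rewrite powRr1 ?ltW//; ring.
  rewrite -powRD ?(gt_eqF x0) ?implybT// subrK powR_mulrn ?ltW//.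
  by rewrite mulrA divfK ?pnatr_eq0.
rewrite ge0_integralZl//.
- by rewrite integral_exprn// expr1n expr0n subr0 mule1.
- by apply/measurable_EFinP/measurable_funTS; measurable_real.
- move=> x /=; rewrite in_itv/= => /andP[x0 _].
  by rewrite lee_fin mulr_ge0// exprn_ge0// ltW.
Qed.

(** Division by zero sends the vertex to the zero vector, which is off the sphere; restriction to
    [unit_sphere] therefore discards it. *)
Let l2norm_direction k (y : k.-tuple R) :
  (l2norm (tnth (direction y)) = (0 < sqnorm y)%R%:R)%R.
Proof.
have [y0|y0] := ltP 0%R (sqnorm y); rewrite /l2norm.
  under eq_bigr do rewrite tnth_mktuple expr_div_n sqr_sqrtr ?sqnorm_ge0//.
  by rewrite -mulr_suml divff ?sqrtr1// gt_eqF.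
have yy : sqnorm y = 0%R by apply/le_anti; rewrite y0 sqnorm_ge0.
rewrite (_ : (\sum_(i < k) _)%R = 0%R) ?sqrtr0// big1// => i _.
by rewrite tnth_mktuple l2normE yy sqrtr0 invr0 mulr0 expr0n.
Qed.

Let linform_direction k (e : 'I_k -> R) (y : k.-tuple R) :
  (linform e (direction y) = linform e y / Num.sqrt (sqnorm y))%R.
Proof.
by rewrite /linform mulr_suml; apply: eq_bigr => i _; rewrite tnth_mktuple mulrA.
Qed.

Lemma measurable_unit_sphere k : measurable (@unit_sphere R k).
Proof.
have := @measurable_l2norm R k measurableT _ (measurable_set1 1%R).
by rewrite setTI.
Qed.

Lemma ge0_integral_sphere_area k (F : k.-tuple R -> \bar R) :
  measurable_fun setT F -> (forall y, 0 <= F y) ->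
  \int[@sphere_area R k]_y F y = \int[lebesgue_tuple R k]_y
    (F (direction y) * (k%:R * \1_(@unit_ball R k) y)%:E).
Proof.
move=> mF F0; apply/esym; apply: ge0_change_of_variables => //.
- exact: measurable_direction.
- apply: measurable_funM => //; apply: measurable_indic.
  exact: measurable_unit_ball.
move=> A mA; have mdA : measurable (@direction R k @^-1` A).
  by rewrite -[X in measurable X]setTI; exact: measurable_direction.
under eq_integral do rewrite EFinM.
rewrite ge0_integralZl//.
- rewrite integral_indic; first by rewrite setIC.
  + exact: mdA.
  + exact: measurable_unit_ball.
- apply/measurable_EFinP/measurable_funTS; apply: measurable_indic.
  exact: measurable_unit_ball.
Qed.

(** The sphere integral is k+2 times the integral of F(<e,y>/|y|) over the ball. By rotation it
    becomes an integral over x = <e,y> and c = |y|^2 with weight (c - x^2)^(p-1); putting x =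
    sqrt(c) u separates u from c. The radial integral 2/(k+2) cancels the dimension and leaves the
    factor 2. *)
Lemma ge0_integral_sphere_linform k (e : 'I_k.+2 -> R) (F : R -> \bar R) :
  l2norm e = 1%R -> measurable_fun setT F -> (forall u, 0 <= F u) ->
  \int[@sphere_area R k.+2]_(y in @unit_sphere R k.+2) F (linform e y) =
  (2 * ball_const R k.+1)%:E *
    \int[mu]_u (F u * (ppow (k.+1%:R / 2) (1 - u ^+ 2))%:E).
Proof.
move=> e1 mF F0; set p : R := (k.+1%:R / 2)%R.
have p0 x : 0 <= (ppow p x)%:E by rewrite lee_fin ppow_ge0.
have B0 : (0 <= ball_const R k.+1)%R by rewrite ltW// ball_const_gt0.
(* Indicator of the ball without its vertex, in terms of the squared norm, with the dimension factor
   of [sphere_area]. *)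
pose chi (b : R) : R := (k.+2%:R * \1_`]0%R, 1%R]%classic b)%R.
have mchi : measurable_fun setT chi.
  by apply: measurable_funM => //; exact: measurable_indic.
have chi0 b : 0 <= (chi b)%:E by rewrite lee_fin mulr_ge0.
pose G (z : R * R) := F (z.1 * (z.2 `^ (- 2^-1)))%R * (chi z.2)%:E.
have mG : measurable_fun setT G.
  apply: emeasurable_funM; last first.
    by apply/measurable_EFinP; apply: measurableT_comp mchi measurable_snd.
  apply: (measurableT_comp mF); apply: measurable_funM => //.
  by apply: (measurableT_comp (measurable_powR _)).
have G0 z : 0 <= G z by rewrite mule_ge0.
transitivity (\int[lebesgue_tuple R k.+2]_y G (linform e y, sqnorm y)).
  rewrite integral_mkcond ge0_integral_sphere_area; last 2 first.
  - apply/(measurable_restrictT _ _).1; first exact: measurable_unit_sphere.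
    by apply: measurable_funTS; apply: (measurableT_comp mF); exact: measurable_linform.
  - by move=> y; rewrite patchE; case: ifPn.
  apply: eq_integral => y _; rewrite patchE /G/= /chi !indicE.
  have -> : (direction y \in @unit_sphere R k.+2) = (0 < sqnorm y)%R.
    apply/idP/idP; rewrite inE /unit_sphere/= l2norm_direction; case: ltP => //.
    by move=> _ /eqP; rewrite eq_sym oner_eq0.
  have -> : (y \in @unit_ball R k.+2) = (sqnorm y <= 1)%R.
    have E : (l2norm (tnth y) <= 1)%R = (sqnorm y <= 1)%R.
      by rewrite l2normE -[X in (_ <= X)%R]sqrtr1 ler_sqrt.
    by rewrite -E; apply/idP/idP; rewrite inE.
  rewrite mem_setE in_itv/=; case: ifPn => y0 /=; last by rewrite mulr0 mul0e mule0.
  rewrite linform_direction powRN powR12_sqrt// ltW//.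
rewrite (ge0_integral_linform_sqnorm e mG G0) e1.
transitivity (\int[mu]_x ((ball_const R k.+1)%:E *
    \int[mu]_c (G (x, c) * (ppow p (c - x ^+ 2))%:E))).
  apply: eq_integral => x _; rewrite mul1r.
  rewrite (@ge0_integral_sqnorm _ k (fun b => G (x, x ^+ 2 + b)%R)).
  - apply: (congr1 (mule _)).
    rewrite -[LHS](@ge0_integral_shift _ _ _ _ (- x ^+ 2)%R).
    + by apply: eq_integral => c _; rewrite addrC subrK.
    + apply: emeasurable_funM; last by apply/measurable_EFinP; measurable_real.
      by apply: (measurableT_comp mG); apply: measurable_fun_pair; measurable_real.
    + by move=> b; rewrite mule_ge0.
  - by apply: (measurableT_comp mG); apply: measurable_fun_pair; measurable_real.
  - by move=> b; exact: G0.
have mH : measurable_fun setT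
    (fun z : R * R => G (z.1, z.2) * (ppow p (z.2 - z.1 ^+ 2))%:E).
  apply: emeasurable_funM; last by apply/measurable_EFinP; measurable_real.
  by apply: (measurableT_comp mG); apply: measurable_fun_pair; measurable_real.
rewrite ge0_integralZl//; last 2 first.
- by apply: measurable_tonelli => [|x b]; [exact: mH|rewrite mule_ge0].
- by move=> x _; apply: integral_ge0 => c _; rewrite mule_ge0.
rewrite [X in _ * X]tonelli; last 2 first.
- exact: mH.
- by move=> x c; rewrite mule_ge0.
set I := \int[mu]_u _.
have I0 : 0 <= I by apply: integral_ge0 => u _; rewrite mule_ge0.
transitivity ((ball_const R k.+1)%:E * \int[mu]_c
    ((k.+2%:R%:E * I) * (ppow (k.+2%:R / 2) c * (c <= 1)%R%:R)%:E)).
  apply: (congr1 (mule _)); apply: eq_integral => c _.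
  have [c0|c0] := leP c 0%R.
    rewrite (ppow_le0 _ c0) mul0r mule0; apply: integral0_eq => x _.
    by rewrite /G /chi/= indicE mem_setE in_itv/= ltNge c0/= mulr0 mule0 mul0e.
  have [c1|c1] := leP c 1%R; last first.
    rewrite mulr0 mule0; apply: integral0_eq => x _.
    by rewrite /G /chi/= indicE mem_setE in_itv/= [(c <= 1)%R]leNgt c1/= andbF mulr0 mule0 mul0e.
  have sc0 : (0 < Num.sqrt c)%R by rewrite sqrtr_gt0.
  have mHc : measurable_fun setT (fun x : R => G (x, c) * (ppow p (c - x ^+ 2))%:E).
    by exact: (measurableT_comp mH (measurable_pair2 c)).
  rewrite -[LHS](ge0_integral_scale mHc _ sc0); last by move=> x; rewrite mule_ge0.
  rewrite mulr1 -muleA muleCA -EFinM -ge0_integralZr; last 4 first.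
  - by [].
  - by apply: emeasurable_funM => //; apply/measurable_EFinP; measurable_real.
  - by move=> u _; rewrite mule_ge0.
  - by rewrite lee_fin mulr_ge0// ppow_ge0.
  apply: eq_integral => u _; rewrite /G/=.
  have -> : (Num.sqrt c * u * c `^ (- 2^-1) = u)%R.
    by rewrite powRN powR12_sqrt ?ltW// mulrAC divff ?mul1r// gt_eqF.
  have -> : chi c = k.+2%:R by rewrite /chi indicE mem_setE in_itv/= c0 c1 mulr1.
  rewrite -!muleA -!EFinM; congr (_ * _%:E).
  have -> : (c - (Num.sqrt c * u) ^+ 2 = c * (1 - u ^+ 2))%R.
    by rewrite exprMn sqr_sqrtr ?ltW//; ring.
  rewrite ppowZ// (ppow_gt0 _ c0).
  (* The extra 1/2 is the Jacobian sqrt(c) of x = sqrt(c) u. *)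
  have -> : (k.+2%:R / 2 - 1 = (p - 1) + 2^-1)%R.
    by rewrite /p -[k.+2%:R]natr1; field.
  by rewrite [in RHS]powRD ?(gt_eqF c0) ?implybT// powR12_sqrt ?ltW//; ring.
have KI0 : 0 <= k.+2%:R%:E * I by rewrite mule_ge0// lee_fin.
rewrite ge0_integralZl; last 4 first.
- by [].
- apply/measurable_EFinP; apply: measurable_funM; first exact: measurable_ppow.
  by rewrite (_ : (fun _ => _) = \1_`]-oo, 1%R]); [exact: measurable_indic|
    apply/funext => x; rewrite indicE mem_setE in_itv].
- by move=> x _; rewrite lee_fin mulr_ge0// ppow_ge0.
- exact: KI0.
rewrite (integral_ppow_le1 k.+1) [X in _ * X]muleAC muleA -!EFinM.
congr (_%:E * _).
by rewrite [X in (_ * X)%R]mulrCA divff ?pnatr_eq0// mulr1 mulrC.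
Qed.

Lemma ppow_mul_conj p u :
  (ppow p (1 + u) * ppow p (1 - u) = ppow p (1 - u ^+ 2) :> R)%R.
Proof.
have -> : (1 - u ^+ 2 = (1 + u) * (1 - u))%R by ring.
have [u1|u1] := leP (1 + u)%R 0%R.
  rewrite (ppow_le0 _ u1) mul0r ppow_le0//; apply: mulr_le0_ge0 => //; lra.
have [u2|u2] := leP (1 - u)%R 0%R.
  by rewrite (ppow_le0 _ u2) mulr0 ppow_le0// pmulr_rle0.
by rewrite !ppow_gt0 ?mulr_gt0// powRM// ltW.
Qed.

End sphere.

(** * Law of the squared distance on the sphere *)

Section zonal_functions.
Context (R : realType).
Notation mu := (@lebesgue_measure R).
Local Open Scope ereal_scope.

Section zonal.
Variables (k : nat) (e : 'I_k.+2 -> R) (b : R).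
Hypotheses (e1 : l2norm e = 1%R) (b0 : (0 < b)%R).
Let p : R := (k.+1%:R / 2)%R.
Let w (y : R) : R := (ppow p (y - 1) * ppow p (1 + 2 * b - y))%R.
(** With y = 1 + b + b u, each factor of [w] scales by b^(p-1) and dy by b, and 2 (p - 1) + 1 =
    k. *)
Let K : R := (2 * ball_const R k.+1 / b ^+ k)%R.
Let zonal (y : k.+2.-tuple R) : R := (1 + b + b * linform e y)%R.

Let w0 y : (0 <= w y)%R.
Proof. by rewrite mulr_ge0// ppow_ge0. Qed.

Let mw : measurable_fun setT w.
Proof. by rewrite /w; measurable_real. Qed.

Let K0 : (0 < K)%R.
Proof. by rewrite divr_gt0 ?exprn_gt0// mulr_gt0// ball_const_gt0. Qed.

Let mzonal : measurable_fun setT zonal.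
Proof.
apply: measurable_funD => //; apply: measurable_funM => //.
exact: measurable_linform.
Qed.

Lemma ge0_integral_zonal (G : R -> \bar R) :
  measurable_fun setT G -> (forall y, 0 <= G y) ->
  \int[@sphere_area R k.+2]_(y in @unit_sphere R k.+2) G (zonal y) =
  K%:E * \int[mu]_y (G y * (w y)%:E).
Proof.
move=> mG G0; have mGw : measurable_fun setT (fun y => G y * (w y)%:E).
  by apply: emeasurable_funM => //; exact/measurable_EFinP.
have Gw0 y : 0 <= G y * (w y)%:E by rewrite mule_ge0// lee_fin w0.
have mGb : measurable_fun setT (fun u : R => G (1 + b + b * u)%R).
  by apply: (measurableT_comp mG); measurable_real.
rewrite (ge0_integral_sphere_linform e1 mGb (fun u => G0 _)).
rewrite -(ge0_integral_affine mGw Gw0 (1 + b)%R b0).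
have -> : \int[mu]_x (G (b * x + (1 + b))%R * (w (b * x + (1 + b)))%:E * b%:E) =
    (b ^+ k)%:E * \int[mu]_u (G (1 + b + b * u)%R * (ppow p (1 - u ^+ 2))%:E).
  rewrite -ge0_integralZl; last 4 first.
  - by [].
  - apply: emeasurable_funM; last by apply/measurable_EFinP; measurable_real.
    by apply: (measurableT_comp mG); measurable_real.
  - by move=> u _; rewrite mule_ge0// lee_fin ppow_ge0.
  - by rewrite lee_fin exprn_ge0// ltW.
  apply: eq_integral => u _; rewrite (addrC (b * u)%R) -muleA [RHS]muleCA -!EFinM.
  congr (_ * _%:E); rewrite /w.
  have -> : (1 + b + b * u - 1 = b * (1 + u))%R by ring.
  have -> : (1 + 2 * b - (1 + b + b * u) = b * (1 - u))%R by ring.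
  rewrite !ppowZ// -ppow_mul_conj.
  have -> : (b ^+ k = b `^ (p - 1) * b `^ (p - 1) * b)%R.
    rewrite -[X in (_ * X)%R]powRr1 ?ltW// -!powRD ?(gt_eqF b0) ?implybT//.
    by rewrite -powR_mulrn ?ltW//; congr powR; rewrite /p -natr1; field.
  ring.
rewrite muleA -EFinM /K divfK//.
by rewrite expf_eq0 (gt_eqF b0) andbF.
Qed.

(** Under the area measure [zonal] has the density [w] up to a constant, so preimages of null sets
    are null. This is what allows [f0] to be modified on a null set under the spherical mean. *)
Lemma ae_zonal (N : set R) : measurable N -> mu N = 0 ->
  {ae @sphere_area R k.+2, forall y, @unit_sphere R k.+2 y -> ~ N (zonal y)}.
Proof.
move=> mN N0; have mzN : measurable (zonal @^-1` N).
  by rewrite -[X in measurable X]setTI; exact: mzonal.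
exists (zonal @^-1` N `&` @unit_sphere R k.+2); split.
- by apply: measurableI => //; exact: measurable_unit_sphere.
- transitivity (\int[@sphere_area R k.+2]_(y in @unit_sphere R k.+2)
      (\1_N (zonal y))%:E).
    have mS := @measurable_unit_sphere R k.+2.
    by rewrite -[LHS](integral_indic _ mS mzN).
  rewrite (@ge0_integral_zonal (fun y => (\1_N y)%:E)).
  + rewrite (_ : \int[mu]_y _ = 0) ?mule0//.
    transitivity (\int[mu]_y (\1_N y * w y)%:E) => //.
    transitivity (\int[mu]_(y in N) (w y)%:E).
      rewrite [RHS]integral_mkcond; apply: eq_integral => y _.
      by rewrite patchE indicE; case: ifPn; rewrite ?mul1r ?mul0r.
    apply: null_set_integral => //.
    exact/measurable_EFinP/measurable_funTS.
  + by apply/measurable_EFinP; exact: measurable_indic.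
  + by move=> y; rewrite lee_fin.
- move=> y /= /not_implyP[Sy]; rewrite /not; split => //.
  exact: contrapT.
Qed.

(** No integrability is assumed: positive and negative parts are transformed separately, and the
    equality persists when both are infinite. *)
Lemma integral_zonal (F : k.+2.-tuple R -> R) (psi : R -> R) (N : set R) :
  measurable_fun setT psi -> measurable N -> mu N = 0 ->
  (forall y, @unit_sphere R k.+2 y -> ~ N (zonal y) -> F y = psi (zonal y)) ->
  \int[@sphere_area R k.+2]_(y in @unit_sphere R k.+2) (F y)%:E =
  K%:E * \int[mu]_y (psi y * w y)%:E.
Proof.
move=> mpsi mN N0 Fpsi; have mEpsi : measurable_fun setT (EFin \o psi).
  exact/measurable_EFinP.
rewrite (@ae_measurable_integral _ _ _ _ _ _ (fun y => (psi (zonal y))%:E)); last 3 first.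
- exact: measurable_unit_sphere.
- by apply: measurable_funTS; exact: measurableT_comp mEpsi mzonal.
- apply: filterS (ae_zonal mN N0) => y /= yN Sy.
  by rewrite Fpsi//; exact: yN.
rewrite integralE [X in _ = _ * X]integralE.
(* For a positive finite factor this distributivity includes the case of two infinite terms, whose
   difference has a conventional value. *)
have mulB (A B : \bar R) : 0 <= A -> 0 <= B ->
    K%:E * (A - B) = K%:E * A - K%:E * B.
  case: A B => [A| |] [B| |] //= _ _; rewrite -?EFinB -?EFinM ?mulrBr ?EFinB//;
  rewrite ?gt0_muley ?gt0_mulNye ?gt0_muleNy ?lte_fin//.
rewrite mulB; last 2 first.
- by apply: integral_ge0.
- by apply: integral_ge0.
congr (_ - _).
- rewrite (_ : (fun y => _) = (EFin \o psi)^\+ \o zonal); last first.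
    by rewrite -funepos_comp.
  rewrite (ge0_integral_zonal (measurable_funepos mEpsi)); last by [].
  apply: (congr1 (mule _)); apply: eq_integral => y _.
  by rewrite !funeposE /= -!EFin_max -EFinM maxr_pMl ?w0// mul0r.
- rewrite (_ : (fun y => _) = (EFin \o psi)^\- \o zonal); last first.
    by rewrite -funeneg_comp.
  rewrite (ge0_integral_zonal (measurable_funeneg mEpsi)); last by [].
  apply: (congr1 (mule _)); apply: eq_integral => y _.
  by rewrite !funenegE /= -!EFin_max -EFinM maxr_pMl ?w0// mul0r mulNr.
Qed.

End zonal.

End zonal_functions.

(** * Orthonormal bases *)

Section dotp.
Context (R : realType) (n : nat).
Implicit Types x y z : 'rV[R]_n.

Lemma dotpC x y : dotp x y = dotp y x.
Proof. by apply: eq_bigr => i _; rewrite mulrC. Qed.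

Lemma dotpDl x y z : dotp (x + y) z = dotp x z + dotp y z.
Proof. by rewrite -big_split; apply: eq_bigr => i _; rewrite mxE mulrDl. Qed.

Lemma dotpZl a x y : dotp (a *: x) y = a * dotp x y.
Proof. by rewrite mulr_sumr; apply: eq_bigr => i _; rewrite mxE mulrA. Qed.

Lemma dotp_suml I (s : seq I) (F : I -> 'rV[R]_n) y :
  dotp (\sum_(i <- s) F i) y = \sum_(i <- s) dotp (F i) y.
Proof.
elim: s => [|i s IHs]; last by rewrite !big_cons dotpDl IHs.
by rewrite !big_nil /dotp big1// => i _; rewrite mxE mul0r.
Qed.

Lemma sqr_enorm x : enorm x ^+ 2 = dotp x x.
Proof.
rewrite /enorm /l2norm sqr_sqrtr; last by apply: sumr_ge0 => i _; exact: sqr_ge0.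
by apply: eq_bigr => i _; rewrite expr2.
Qed.

Lemma enorm_gt0 x : x != 0 -> 0 < enorm x.
Proof.
move=> x0; rewrite lt0r sqrtr_ge0 andbT; apply: contra x0.
rewrite -sqrf_eq0 sqr_enorm psumr_eq0; last by move=> i _; rewrite -expr2 sqr_ge0.
move=> /allP x0; apply/eqP/rowP => i; rewrite mxE.
have := x0 i (mem_index_enum _); rewrite -expr2 sqrf_eq0 => /eqP ->//.
Qed.

(** The length is free of [\dim xi], so the dimension can be replaced by its value without casts. *)
Definition orthonormal d (e : d.-tuple 'rV[R]_n) : Prop :=
  forall i j, dotp (tnth e i) (tnth e j) = (i == j)%:R.

Lemma dotp_sum_orthonormal d (e : d.-tuple 'rV[R]_n) (c : 'I_d -> R) j :
  orthonormal e -> dotp (\sum_(i < d) c i *: tnth e i) (tnth e j) = c j.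
Proof.
move=> oe; rewrite dotp_suml (bigD1 j)//= dotpZl oe eqxx mulr1.
rewrite big1 ?addr0// => i ij.
by rewrite dotpZl oe (negbTE ij) mulr0.
Qed.

Lemma orthonormal_sumE d (e : d.-tuple 'rV[R]_n) x : orthonormal e ->
  x \in <<e>>%VS -> x = \sum_(i < d) dotp x (tnth e i) *: tnth e i.
Proof.
move=> oe /coord_span xE.
have {}xE : x = \sum_(i < d) coord e i x *: tnth e i.
  by rewrite [LHS]xE; apply: eq_bigr => i _; rewrite (tnth_nth 0).
rewrite [LHS]xE; apply: eq_bigr => i _; congr (_ *: _).
by rewrite [in RHS]xE dotp_sum_orthonormal.
Qed.

(** Gram-Schmidt by induction: a complement [W] of a line spanned by [v] has an orthonormal basis,
    and [v] minus its projection to [W] is normalized. *)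
Lemma exists_orthonormal d (U : {vspace 'rV[R]_n}) : \dim U = d ->
  exists2 e : d.-tuple 'rV[R]_n, orthonormal e & <<e>>%VS = U.
Proof.
elim: d U => [|d IHd] U dU.
  exists [tuple] => [[]//|]; apply/esym/eqP.
  by rewrite span_nil -dimv_eq0 dU.
pose v := vpick U; pose W := (U :\: <[v]>)%VS.
have vU : v \in U by exact: memv_pick.
have v0 : v != 0 by rewrite vpick0 -dimv_eq0 dU.
have capE : (U :&: <[v]> = <[v]>)%VS by apply/capv_idPr; rewrite -memvE.
have dW : \dim W = d.
  have := dimv_cap_compl U <[v]>%VS; rewrite capE dim_vline v0 dU add1n.
  by move=> [].
have WU : (W <= U)%VS by exact: diffvSl.
have vW : v \notin W.
  apply: contra v0 => vW; rewrite -memv0 -(capv_diff U <[v]>%VS).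
  by rewrite memv_cap vW memv_line.
have [e oe eW] := IHd W dW.
pose p := \sum_(i < d) dotp v (tnth e i) *: tnth e i.
have pW : p \in W.
  apply: memv_suml => i _; apply: memvZ; rewrite -eW.
  by apply: memv_span; exact: mem_tnth.
have vp0 : v - p != 0 by apply: contra vW; rewrite subr_eq0 => /eqP ->.
pose u := (enorm (v - p))^-1 *: (v - p).
have nz := enorm_gt0 vp0.
have uu : dotp u u = 1.
  rewrite /u dotpZl dotpC dotpZl -sqr_enorm expr2 mulKf ?mulVf ?gt_eqF//.
have ue j : dotp u (tnth e j) = 0.
  rewrite /u dotpZl dotpDl -scaleN1r dotpZl dotp_sum_orthonormal//.
  by rewrite mulN1r subrr mulr0.
exists [tuple of u :: e].
  move=> i j; case: (unliftP ord0 i) => [i'|] ->; case: (unliftP ord0 j) => [j'|] ->.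
  - by rewrite !tnthS oe (inj_eq lift_inj).
  - by rewrite tnthS tnth0 dotpC ue.
  - by rewrite tnthS tnth0 ue.
  - by rewrite tnth0 uu.
rewrite span_cons eW; apply/eqP; rewrite eqEsubv; apply/andP; split.
  rewrite subv_add WU andbT -memvE; apply: memvZ; apply: memvB => //.
  exact: (subvP WU).
rewrite -{1}(addv_diff_cap U <[v]>%VS) capE subv_add addvSr -memvE.
rewrite (_ : v = enorm (v - p) *: u + p); last first.
  by rewrite /u scalerA divff ?gt_eqF// scale1r subrK.
by apply: memv_add => //; apply: memvZ; exact: memv_line.
Qed.

End dotp.

(** * Riemann-Liouville integrals *)

Section riemann_liouville.
Context (R : realType).
Notation mu := (@lebesgue_measure R).

(** This is the total mass of the exponential distribution. *)
Lemma Gamma1 : Gamma (1 : R) = 1.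
Proof.
rewrite fine_egamma; suff -> : egamma (1 : R) = 1%E by [].
rewrite -(integral_exponential_pdf (@ltr01 R)) /egamma.
have -> : (\int[mu]_x (exponential_pdf 1 x)%:E =
    \int[mu]_(x in `[0%R, +oo[) (expR (- x))%:E)%E.
  rewrite [RHS]integral_mkcond; apply: eq_integral => x _.
  rewrite /exponential_pdf !patchE; case: ifPn => // _.
  by rewrite mul1r mulN1r.
rewrite -integral_itv_obnd_cbnd; last first.
  by apply/measurable_EFinP/measurable_funTS; measurable_real.
rewrite [RHS]integral_mkcond; apply: eq_integral => x _.
rewrite patchE mem_setE in_itv/= andbT ppow1.
by case: ifPn => _; rewrite ?mul1r ?mul0r.
Qed.

Lemma RL_integralE (alpha a : R) (phi : R -> R) (x : R) :
  (forall y, y <= a -> phi y = 0) ->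
  RL_integral alpha a phi x = (Gamma alpha)^-1 *
    fine (\int[mu]_y (phi y * ppow alpha (x - y))%:E)%E.
Proof.
move=> phia; rewrite /RL_integral /Rintegral; congr (_ * fine _).
rewrite integral_mkcond; apply: eq_integral => y _.
rewrite patchE mem_setE in_itv/=; have [ya|ya]/= := leP y a.
  by rewrite phia// mul0r.
by rewrite /ppow subr_gt0; case: ifPn => // _; rewrite mulr0.
Qed.

(* [RL_integral p 1 phi z] for a function [phi] vanishing on ]-oo, 1]. *)
Definition fracint (phi : R -> R) (p z : R) : R :=
  (Gamma p)^-1 * fine (\int[mu]_y (phi y * ppow p (z - y))%:E)%E.

Section fractional.
Variables (phi : R -> R).
Hypotheses (mphi : measurable_fun setT phi) (phi1 : forall y, y <= 1 -> phi y = 0).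
Hypothesis phi_loc : forall z : R,
  (\int[mu]_(y in `]-oo, z]) `|phi y|%:E < +oo)%E.

Let mkernel p (z : R) : measurable_fun setT (fun y : R => phi y * ppow p (z - y)).
Proof. by apply: measurable_funM => //; measurable_real. Qed.

(** For p >= 1 the kernel is bounded where 1 < y < z, so local integrability of [phi] gives
    convergence at every z. For p < 1 it is obtained only almost everywhere, from Fubini's
    theorem. *)
Lemma integrable_RL_kernel p (z : R) : 1 <= p ->
  mu.-integrable setT (fun y : R => (phi y * ppow p (z - y))%:E).
Proof.
move=> p1; apply/integrableP; split; first by apply/measurable_EFinP; exact: mkernel.
pose C := (Num.max (z - 1) 0) `^ (p - 1).
apply: (@le_lt_trans _ _ (\int[mu]_(y in `]-oo, z]) (C%:E * `|phi y|%:E))%E).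
  rewrite [leRHS]integral_mkcond; apply: ge0_le_integral => //.
  - by apply/measurableT_comp => //; apply/measurable_EFinP; exact: mkernel.
  - apply/(measurable_restrictT _ _).1 => //; apply: measurable_funTS.
    by apply: emeasurable_funM => //; apply/measurable_EFinP; apply: measurableT_comp.
  move=> y _; rewrite patchE mem_setE in_itv/=.
  have [yz|yz] := leP y z; last first.
    by rewrite ppow_le0 ?mulr0 ?normr0// subr_le0 ltW.
  rewrite -EFinM lee_fin normrM mulrC (ger0_norm (ppow_ge0 _ _)).
  have [y1|y1] := leP y 1; first by rewrite phi1// normr0 !mulr0.
  rewrite ler_wpM2r// /ppow; case: ifPn => yz0; last exact: powR_ge0.
  apply: ge0_ler_powR; rewrite ?subr_ge0//.
  - by rewrite nnegrE ltW.
  - by rewrite nnegrE le_max lexx orbT.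
  - by rewrite le_max lerD2l lerN2 (ltW y1).
rewrite ge0_integralZl//.
- by rewrite lte_mul_pinfty// lee_fin powR_ge0.
- by apply: measurable_funTS; apply/measurable_EFinP; apply: measurableT_comp.
- by rewrite lee_fin powR_ge0.
Qed.

(** Measurability must not depend on convergence, so Tonelli's theorem is applied to each of the two
    signed parts. *)
Lemma measurable_fracint p : measurable_fun setT (fracint phi p).
Proof.
apply: measurable_funM => //.
apply: (measurableT_comp (fine_measurable measurableT)).
pose g (z : R * R) : \bar R := (phi z.2 * ppow p (z.1 - z.2))%:E.
have mg : measurable_fun setT g.
  apply/measurable_EFinP; apply: measurable_funM; last by measurable_real.
  exact: measurableT_comp mphi measurable_snd.
rewrite (_ : (fun _ => _) =
    (fun y => \int[mu]_s (g^\+ (y, s)) - \int[mu]_s (g^\- (y, s)))%E); last first.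
  apply/funext => y; rewrite integralE; congr (_ - _)%E.
  - by apply: eq_integral => s _; rewrite !funeposE.
  - by apply: eq_integral => s _; rewrite !funenegE.
have mgp : measurable_fun setT g^\+%E by exact: measurable_funepos.
have mgn : measurable_fun setT g^\-%E by exact: measurable_funeneg.
apply: emeasurable_funB.
- exact: (@measurable_fun_fubini_tonelli_F _ _ _ _ R mu _ mgp (funepos_ge0 g)).
- exact: (@measurable_fun_fubini_tonelli_F _ _ _ _ R mu _ mgn (funeneg_ge0 g)).
Qed.

Let convE m n (z s : R) :
  (\int[mu]_y (ppow (m.+1%:R / 2) (y - s) * ppow (n.+1%:R / 2) (z - y))%:E =
  (Gamma (m.+1%:R / 2) * Gamma (n.+1%:R / 2) / Gamma ((m + n).+2%:R / 2) *
   ppow ((m + n).+2%:R / 2) (z - s))%:E)%E.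
Proof.
rewrite -integral_ppow_conv_halfn.
rewrite -[LHS](@ge0_integral_shift _ _ _ _ s).
- by apply: eq_integral => y _; rewrite addrK opprD addrA addrAC.
- by apply/measurable_EFinP; measurable_real.
- by move=> y; rewrite lee_fin mulr_ge0// ppow_ge0.
Qed.

Section semigroup.
Variables (m n : nat) (z : R).
Let p : R := m.+1%:R / 2.
Let q : R := n.+1%:R / 2.
Let r : R := (m + n).+2%:R / 2.
(** The Beta value B(p, q). *)
Let B : R := Gamma p * Gamma q / Gamma r.
Let f (y : R * R) : \bar R :=
  (phi y.2 * (ppow p (y.1 - y.2) * ppow q (z - y.1)))%:E.

Let r1 : 1 <= r.
Proof. by rewrite /r ler_pdivlMr// mul1r ler_nat. Qed.

Let mf : measurable_fun setT f.
Proof.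
apply/measurable_EFinP; apply: measurable_funM; last by measurable_real.
exact: measurableT_comp mphi measurable_snd.
Qed.

Let integrable_ppow_prod s : mu.-integrable setT
  (fun y : R => (ppow p (y - s) * ppow q (z - y))%:E).
Proof.
apply/integrableP; split; first by apply/measurable_EFinP; measurable_real.
under eq_integral do rewrite gee0_abs ?lee_fin ?mulr_ge0 ?ppow_ge0//.
by rewrite (convE m n) ltry.
Qed.

Let integral_fr s : (\int[mu]_y f (y, s) = (phi s * ppow r (z - s) * B)%:E)%E.
Proof.
rewrite /f/=; under eq_integral do rewrite EFinM.
rewrite (integralZl measurableT (integrable_ppow_prod s)) (convE m n) -EFinM.
by congr EFin; rewrite /B mulrCA mulrC mulrA.
Qed.

(** Integrating |f| in y first leaves |phi| against the kernel of order [r], which is at least 1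
    even when p = q = 1/2. *)
Let integrable_f : (mu \x mu)%E.-integrable setT f.
Proof.
apply/integrable21ltyP; first exact: mf.
have B0 : 0 <= B by rewrite !mulr_ge0 ?invr_ge0// ltW// Gamma_halfn_gt0.
have -> : (\int[mu]_s \int[mu]_y `|f (y, s)| =
    \int[mu]_s (B%:E * `|(phi s * ppow r (z - s))%:E|))%E.
  apply: eq_integral => s _.
  transitivity (\int[mu]_y (`|phi s|%:E *
      (ppow p (y - s) * ppow q (z - y))%:E))%E.
    apply: eq_integral => y _.
    rewrite /f /= normrM EFinM; congr (_ * _%:E)%E.
    by rewrite ger0_norm// mulr_ge0 ?ppow_ge0.
  rewrite (integralZl measurableT (integrable_ppow_prod s)) (convE m n) -!EFinM.
  congr EFin.
  by rewrite normrM (ger0_norm (ppow_ge0 _ _)) mulrCA.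
rewrite ge0_integralZl//; last first.
  by apply: measurableT_comp => //; apply/measurable_EFinP; exact: mkernel.
have /integrableP[_ foo] := integrable_RL_kernel z r1.
by rewrite lte_mul_pinfty// lee_fin.
Qed.

Let F (y : R) : \bar R := (\int[mu]_s f (y, s))%E.

Let integrable_F : mu.-integrable setT F.
Proof. exact: integrable_fubini_F integrable_f. Qed.

Let G (y : R) : R := fracint phi p y * ppow q (z - y).

Let measurable_G : measurable_fun setT G.
Proof.
by apply: measurable_funM; [exact: measurable_fracint|measurable_real].
Qed.

(** [fracint] takes the finite part of its integral, so it represents the inner integral only where
    that converges, which Fubini's theorem ensures for almost every y. *)
Let ae_FG : ae_eq mu setT F (fun y => (Gamma p * G y)%:E).
Proof.
have gp := Gamma_halfn_gt0 R m.
apply: filterS (ae_integrable1 integrable_f) => y /= fy _.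
rewrite /G /fracint !mulrA mulfV ?gt_eqF// mul1r /F.
(* A vanishing outer kernel gives no information on the inner integral, but both sides are then 0;
   otherwise the kernel can be divided out. *)
have [q0|q0] := eqVneq (ppow q (z - y)) 0.
  rewrite q0 mulr0; apply: integral0_eq => s _.
  by rewrite /f/= q0 !mulr0.
have gy : mu.-integrable setT (fun s : R => (phi s * ppow p (y - s))%:E).
  have := integrableZl measurableT (ppow q (z - y))^-1 fy.
  apply: eq_integrable => // s _.
  by rewrite /f/= -EFinM; congr EFin; field.
rewrite EFinM fineK; last exact: integrable_fin_num gy.
rewrite muleC -(integralZl measurableT gy); apply: eq_integral => s _.
by rewrite /f/= -EFinM; congr EFin; ring.
Qed.

Lemma integrable_RL_semigroup : mu.-integrable setT (EFin \o G).
Proof.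
have gp := Gamma_halfn_gt0 R m.
have iG : mu.-integrable setT (fun y => (Gamma p * G y)%:E).
  apply/integrableP; split.
    by apply/measurable_EFinP; apply: measurable_funM.
  have /integrableP[mF] := integrable_F; apply: le_lt_trans.
  rewrite le_eqVlt; apply/orP; left; apply/eqP/ae_eq_integral => //.
  - apply: measurableT_comp => //.
    by apply/measurable_EFinP; apply: measurable_funM.
  - exact: measurableT_comp.
  - by apply: filterS ae_FG => y /= + _ => ->.
have := integrableZl measurableT (Gamma p)^-1 iG.
apply: eq_integrable => // y _ /=.
by rewrite -EFinM mulKf// gt_eqF.
Qed.

(** After the exchange of integrals the inner one is a Beta integral, whose constant [B] cancels the
    Gamma factors. *)
Lemma RL_semigroup :
  (Gamma q)^-1 * fine (\int[mu]_y (G y)%:E)%E = fracint phi r z.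
Proof.
have gp := Gamma_halfn_gt0 R m; have gq := Gamma_halfn_gt0 R n.
have gr := Gamma_halfn_gt0 R (m + n).+1.
have -> : (\int[mu]_y (G y)%:E = (Gamma p)^-1%:E * \int[mu]_y F y)%E.
  have -> : (\int[mu]_y F y = \int[mu]_y (Gamma p * G y)%:E)%E.
    apply: ae_eq_integral => //; first by case/integrableP : integrable_F.
    by apply/measurable_EFinP; apply: measurable_funM.
  have -> : (\int[mu]_y (Gamma p * G y)%:E = (Gamma p)%:E * \int[mu]_y (G y)%:E)%E.
    by rewrite -(integralZl measurableT integrable_RL_semigroup).
  by rewrite muleA -EFinM (mulVf (lt0r_neq0 gp)) mul1e.
rewrite /F (Fubini integrable_f).
under eq_integral do rewrite integral_fr EFinM.
have ir := integrable_RL_kernel z r1.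
rewrite (integralZr measurableT ir) -(fineK (integrable_fin_num measurableT ir)).
rewrite -!EFinM/= /fracint /B.
rewrite -/r in gr *; move: (fine _) => I.
move: (Gamma p) (Gamma q) (Gamma r) gp gq gr => gp gq gr gp0 gq0 gr0.
by field; rewrite !gt_eqF.
Qed.

End semigroup.

End fractional.

End riemann_liouville.

(** * Iterated primitives and inversion *)

Section derivatives.
Context (R : realType).
Notation mu := (@lebesgue_measure R).
Variables (phi : R -> R).
Hypotheses (mphi : measurable_fun setT phi) (phi1 : forall y, y <= 1 -> phi y = 0).
Hypothesis phi_loc : forall z : R,
  (\int[mu]_(y in `]-oo, z]) `|phi y|%:E < +oo)%E.

Lemma fracint_le1 p z : z <= 1 -> fracint phi p z = 0.
Proof.
move=> z1; rewrite /fracint integral0_eq ?mulr0// => y _.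
have [y1|y1] := leP y 1; first by rewrite phi1// mul0r.
by rewrite ppow_le0 ?mulr0// subr_le0 (le_trans z1)// ltW.
Qed.

(** The integral of integer order j, with the order written as a half-integer to fit the semigroup
    law. *)
Let J (j : nat) : R -> R := fracint phi (j.*2%:R / 2).

Let two2 : (2 / 2 = 1 :> R)%R. Proof. by rewrite divff. Qed.

Let mulr_ppow1 (g : R -> R) (z : R) : (fun y => (g y * ppow (2 / 2) (z - y))%:E) =
  (EFin \o g) \_ `]-oo, z[.
Proof.
apply/funext => y; rewrite patchE mem_setE in_itv/= two2 ppow1 subr_gt0.
by case: ifPn => _; rewrite ?mulr1 ?mulr0.
Qed.

Let integral_ppow1 (g : R -> R) (z : R) : measurable_fun setT g ->
  fine (\int[mu]_y (g y * ppow (2 / 2) (z - y))%:E)%E =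
  \int[mu]_(y in `]-oo, z]) g y.
Proof.
move=> mg; rewrite mulr_ppow1 -integral_mkcond /Rintegral; congr fine.
by apply: integral_itv_bndo_bndc; apply/measurable_funTS/measurable_EFinP.
Qed.

Let integrable_phi z : mu.-integrable `]-oo, z] (EFin \o phi).
Proof.
apply/integrableP; split; last exact: phi_loc.
exact/measurable_funTS/measurable_EFinP.
Qed.

Let J1E z : J 1 z = \int[mu]_(y in `]-oo, z]) phi y.
Proof. by rewrite /J /fracint integral_ppow1// two2 Gamma1 invr1 mul1r. Qed.

Let mJ j : measurable_fun setT (J j).
Proof. exact: measurable_fracint. Qed.

Let JSE j z : J j.+2 z = \int[mu]_(y in `]-oo, z]) J j.+1 y.
Proof.
(* The indices 2j+1 and 1 stand for the orders j+1 and 1, with sum j+2. *)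
rewrite -integral_ppow1//; have := RL_semigroup mphi phi1 phi_loc j.*2.+1 1 z.
by rewrite /= two2 Gamma1 invr1 mul1r /J addn1 => <-.
Qed.

Let integrable_J j z : mu.-integrable `]-oo, z] (EFin \o J j.+1).
Proof.
(* At z + 1 the kernel of order 1 is the indicator of ]-oo, z + 1[, which contains ]-oo, z]. *)
have /= := integrable_RL_semigroup mphi phi1 phi_loc j.*2.+1 1 (z + 1).
rewrite (_ : EFin \o _ = (EFin \o J j.+1) \_ `]-oo, z + 1[); last first.
  by rewrite -mulr_ppow1.
rewrite -integrable_mkcond//.
apply: integrableS => //; apply: subset_itvl.
by rewrite bnd_simp ltrDl.
Qed.

Let continuous_J j : continuous (J j.+1).
Proof.
elim: j => [|j IHj] z.
  (* Below both z and 1: [phi] vanishes to the left of [a], so a compact interval around z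
     suffices. *)
  pose a := Num.min z 1 - 1; have az : a < z.
    by rewrite ltrBlDr gt_min ltrDl ltr01.
  have a1 : a < 1 by rewrite ltrBlDr gt_min orbC ltrDl ltr01.
  have zz : z < z + 1 by rewrite ltrDl.
  rewrite (_ : J 1 = fun x => \int[mu]_(y in `[a, x]) phi y); last first.
    apply/funext => x; rewrite J1E Rintegral_mkcond [RHS]Rintegral_mkcond.
    apply: eq_Rintegral => y _; rewrite !patchE !mem_setE !in_itv/=.
    have [//|ya] := leP a y; case: ifPn => // _.
    by rewrite phi1// ltW// (lt_trans ya).
  have ia : mu.-integrable `[a, z + 1] (EFin \o phi).
    by apply: integrableS (integrable_phi (z + 1)) => //; exact: subset_itvr.
  have /continuous_within_itvP := parameterized_integral_continuous (ltW (lt_trans az zz)) ia.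
  move=> /(_ (lt_trans az zz))[+ _ _]; apply.
  by rewrite in_itv/= az.
suff : derivable (J j.+2) z 1.
  by move=> /derivable1_diffP/differentiable_continuous.
have zz : z < z + 1 by rewrite ltrDl.
rewrite (_ : J j.+2 = fun z => \int[mu]_(y in `]-oo, z]) J j.+1 y); last first.
  by apply/funext => y; rewrite JSE.
by have [] := continuous_FTC1 zz (integrable_J j _) (ltNyr _) (IHj z).
Qed.

Let derivable_J j z : derivable (J j.+2) z 1 /\ derive1 (J j.+2) z = J j.+1 z.
Proof.
have zz : z < z + 1 by rewrite ltrDl.
rewrite (_ : J j.+2 = fun z => \int[mu]_(y in `]-oo, z]) J j.+1 y); last first.
  by apply/funext => y; rewrite JSE.
have := continuous_FTC1 zz (integrable_J j _) (ltNyr _) (@continuous_J j z).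
by [].
Qed.

(** [phi] is only locally integrable, so this last derivative rests on Lebesgue's theorem; all
    earlier ones have continuous integrands and exist everywhere. *)
Let ae_derivable_J1 :
  {ae mu, forall z, derivable (J 1) z 1 /\ derive1 (J 1) z = phi z}.
Proof.
rewrite (_ : J 1 = fun z => \int[mu]_(y in `]-oo, z]) phi y); last first.
  by apply/funext => y; rewrite J1E.
apply: FTC1Ny => //.
split => //; first exact: openT.
move=> K _ cK; have [M [_ KM]] := compact_bounded cK.
have {}KM y : K y -> y <= M + 1.
  by move=> Ky; apply: le_trans (ler_norm _) (KM _ _ _ Ky); rewrite ltrDl.
apply: le_lt_trans (phi_loc (M + 1)); apply: ge0_subset_integral => //.
- exact: compact_measurable.
- apply/measurable_EFinP/measurable_funTS; exact: measurableT_comp.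
Qed.

Let derive1n_J m j : (j <= m)%N -> derive1n j (J m.+1) = J (m - j).+1.
Proof.
elim: j => [|j IHj] jm; first by rewrite subn0.
rewrite derive1nS IHj; last exact: ltnW.
rewrite -(subnSK jm); apply/funext => z.
by have [] := derivable_J (m - j.+1) z.
Qed.

Let ae_derivable_fracint m : {ae mu, forall z,
  [/\ forall j, (j < m)%N -> forall y, derivable (derive1n j (J m.+1)) y 1,
      derivable (derive1n m (J m.+1)) z 1 &
      derive1n m.+1 (J m.+1) z = phi z]}.
Proof.
apply: (@filterS _ _ (ae_filter_ringOfSetsType mu) _ _ _ ae_derivable_J1) => z [dz dphi]; split.
- move=> j jm y; rewrite derive1n_J; last exact: ltnW.
  rewrite -(subnSK jm).
  by have [] := derivable_J (m - j.+1) y.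
- rewrite (derive1n_J (leqnn m)) subnn; exact: dz.
- rewrite derive1nS (derive1n_J (leqnn m)) subnn; exact: dphi.
Qed.

Section inversion.
Variables (k : nat) (H : R -> R).
Let alpha : R := k.+1%:R / 2.
Hypothesis HE : forall v, 1 < v -> H v = fracint phi alpha v.
(** The integer part of [alpha]. The complementary order [beta] is 1/2 for even k and 1 for odd k,
    when [alpha] is an integer. *)
Let m := uphalf k.
Let beta : R := (odd k).+1%:R / 2.

Let alphaE : alpha = m%:R + 1 - beta.
Proof.
rewrite /alpha /beta -[in LHS](odd_double_half k) /m uphalf_half.
rewrite -!natr1 !natrD -muln2 natrM.
by field.
Qed.

Let truncn_alpha : Num.truncn alpha = m.
Proof.
apply: truncn_def; rewrite alphaE /beta -[m.+1%:R]natr1.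
have b1 : 1 <= (odd k).+1%:R :> R by rewrite ler1n.
have b2 : (odd k).+1%:R <= 2 :> R by rewrite ler_nat; case: odd.
by apply/andP; split; lra.
Qed.

(** As alpha + beta = m + 1, the semigroup law gives an integral of integer order. *)
Let RL_primitiveE : RL_primitive alpha 1 H = J m.+1.
Proof.
apply/funext => z; rewrite /RL_primitive truncn_alpha.
have -> : 1 - (alpha - m%:R) = beta by rewrite alphaE; ring.
(* Nothing is known of [H] up to 1, but the integral over ]1, z[ sees only larger arguments. *)
have -> : RL_integral beta 1 H z = RL_integral beta 1 (fracint phi alpha) z.
  rewrite /RL_integral; congr (_ * _); apply: eq_Rintegral => y.
  by rewrite inE/= in_itv/= => /andP[y1 _]; rewrite HE.
rewrite RL_integralE; last by move=> y; exact: fracint_le1.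
have := RL_semigroup mphi phi1 phi_loc k (odd k) z.
rewrite /= -/alpha -/beta => ->.
rewrite /J /m; congr (fracint phi (_%:R / 2) z).
rewrite doubleS uphalf_half doubleD -[X in (X + odd k).+2]odd_double_half.
by rewrite addnAC addnn.
Qed.

(** The primitive is [J m.+1]: its first m derivatives exist everywhere, and the last one exists and
    equals [phi] almost everywhere. *)
Lemma ae_RL_inversion : {ae mu, forall v, 1 < v ->
  RL_derivable alpha 1 H v /\ RL_derivative alpha 1 H v = phi v}.
Proof.
have nearE (x : R) (P : set R) : (forall z, P z) -> \forall z \near x, P z.
  by move=> Pz; apply/nbhs_ballP; exists 1 => //= y _; exact: Pz.
apply: (@filterS _ _ (ae_filter_ringOfSetsType mu) _ _ _ (ae_derivable_fracint m)) => v [dJ dJm Jphi] v1.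
rewrite /RL_derivable /RL_derivative truncn_alpha RL_primitiveE.
split; [split|]; [|by move=> j jm; apply: nearE => z; exact: dJ|exact: dJm|exact: Jphi].
apply: nearE => z.
have := integrable_RL_semigroup mphi phi1 phi_loc k (odd k) z.
rewrite /= -/alpha -/beta => iG.
have iG1 : mu.-integrable `]1, z[
    (EFin \o (fun y : R => fracint phi alpha y * ppow beta (z - y))).
  exact: integrableS iG.
move: iG1; apply: eq_integrable => // y.
rewrite inE/= in_itv/= => /andP[y1 yz].
rewrite HE// ppow_gt0 ?subr_gt0//.
by congr (_ * _ `^ _)%:E; rewrite alphaE; ring.
Qed.

End inversion.

End derivatives.

(** * Spherical means of radial functions *)

Section null_sets.
Context (R : realType).
Notation mu := (@lebesgue_measure R).
Local Open Scope ereal_scope.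

Let measurable_sqrt : measurable_fun setT (@Num.sqrt R).
Proof. by apply: continuous_measurable_fun; exact: sqrt_continuous. Qed.

Let integral_indic_null (D N : set R) (h : R -> R) :
  measurable D -> measurable N -> mu N = 0 -> measurable_fun D h ->
  \int[mu]_(x in D) ((\1_N x)%:E * (h x)%:E) = 0.
Proof.
move=> mD mN N0 mh; transitivity (\int[mu]_(x in D) cst 0 x); last exact: integral0.
apply: ae_eq_integral => //.
  by apply: emeasurable_funM; apply/measurable_EFinP => //; exact: measurable_indic.
exists N; split => // x /= /not_implyP[_]; rewrite indicE.
by have [/set_mem//|_] := boolP (x \in N); rewrite mul0e.
Qed.

Lemma measurable_preimage_sqrt (N : set R) : measurable N ->
  measurable (`]0%R, +oo[ `&` (@Num.sqrt R) @^-1` N).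
Proof.
move=> mN; apply: measurableI => //.
by rewrite -[X in measurable X]setTI; exact: measurable_sqrt.
Qed.

(** With y = x^2 the measure of the preimage is the integral of 2 x over the positive part of
    [N]. *)
Lemma null_preimage_sqrt (N : set R) : measurable N -> mu N = 0 ->
  mu (`]0%R, +oo[ `&` (@Num.sqrt R) @^-1` N) = 0.
Proof.
move=> mN N0.
have mG : measurable_fun setT (fun y : R => (\1_N (Num.sqrt y) : R)%:E).
  apply/measurable_EFinP; apply: measurableT_comp measurable_sqrt.
  exact: measurable_indic.
transitivity (\int[mu]_(y in `]0%R, +oo[) (\1_N (Num.sqrt y))%:E).
  have mpre : measurable ((@Num.sqrt R) @^-1` N).
    by rewrite -[X in measurable X]setTI; exact: measurable_sqrt.
  have := @integral_indic _ _ R mu _ (measurable_itv `]0%R, +oo[) _ mpre.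
  by rewrite setIC => <-.
have G0 (y : R) : 0 <= (\1_N (Num.sqrt y) : R)%:E by rewrite lee_fin.
rewrite -(ge0_integral_sqr mG G0).
rewrite -[RHS](@integral_indic_null `]0%R, +oo[%classic N (fun x => 2 * x)%R)//.
- apply: eq_integral => x; rewrite inE/= in_itv/= andbT => x0.
  by rewrite sqrtr_sqr gtr0_norm.
- by apply: measurable_funTS; measurable_real.
Qed.

Lemma null_preimage_sqr (N : set R) : measurable N -> mu N = 0 ->
  mu (`]0%R, +oo[ `&` (fun s : R => (s ^+ 2)%R) @^-1` N) = 0.
Proof.
move=> mN N0.
have msqr : measurable_fun setT (fun s : R => (s ^+ 2)%R) by measurable_real.
have mpre : measurable ((fun s : R => (s ^+ 2)%R) @^-1` N).
  by rewrite -[X in measurable X]setTI; exact: msqr.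
transitivity (\int[mu]_(y in `]0%R, +oo[) (\1_N (y ^+ 2)%R)%:E).
  have := @integral_indic _ _ R mu _ (measurable_itv `]0%R, +oo[) _ mpre.
  by rewrite setIC => <-.
(* The weight y^(-1/2) / 2 cancels the Jacobian 2 s at y = s^2. *)
pose G (y : R) : \bar R := (\1_N y)%:E * (ppow (1 / 2) y / 2)%:E.
have mG : measurable_fun setT G.
  apply: emeasurable_funM; apply/measurable_EFinP; last by measurable_real.
  exact: measurable_indic.
have G0 y : 0 <= G y by rewrite mule_ge0// lee_fin divr_ge0// ppow_ge0.
transitivity (\int[mu]_(s in `]0%R, +oo[) (G (s ^+ 2)%R * (2 * s)%:E)).
  apply: eq_integral => s; rewrite inE/= in_itv/= andbT => s0.
  rewrite /G -muleA -EFinM ppow_gt0 ?exprn_gt0//.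
  rewrite (_ : 1 / 2 - 1 = 2^-1 * (-1))%R; last by field.
  rewrite powRrM powR12_sqrt ?sqr_ge0// sqrtr_sqr gtr0_norm// powR_inv1 ?ltW//.
  have -> : (s^-1 / 2 * (2 * s) = 1)%R by field; rewrite gt_eqF.
  by rewrite mulr1.
rewrite (ge0_integral_sqr mG G0).
apply: integral_indic_null => //.
by apply: measurable_funTS; measurable_real.
Qed.

End null_sets.

(** * The spherical mean as a fractional integral *)

Section spherical_mean.
Context (R : realType) (n k : nat).
Notation mu := (@lebesgue_measure R).
Variables (f : 'rV[R]_n -> R) (psi : R -> R) (N : set R).
Hypotheses (mpsi : measurable_fun setT psi) (mN : measurable N) (N0 : mu N = 0%E).
Hypothesis fpsi : forall y, 1 < enorm y -> ~ N (enorm y ^+ 2) ->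
  f y = psi (enorm y ^+ 2).
Let p : R := k.+1%:R / 2.

Lemma sqr_enorm_sum d (e : d.-tuple 'rV[R]_n) (u : 'I_d -> R) : orthonormal e ->
  enorm (\sum_(i < d) u i *: tnth e i) ^+ 2 = \sum_(i < d) u i ^+ 2.
Proof.
move=> oe; rewrite sqr_enorm dotp_suml; apply: eq_bigr => i _.
by rewrite dotpZl dotpC dotp_sum_orthonormal.
Qed.

Lemma sphere_integralE (e : k.+2.-tuple 'rV[R]_n) (x : 'rV[R]_n) :
  orthonormal e -> x \in <<e>>%VS -> 1 < enorm x ->
  let b := 2 * enorm x * (enorm x - 1) in
  (\int[@sphere_area R k.+2]_(c in @unit_sphere R k.+2)
    (f (x + (enorm x - 1) *: \sum_(i < k.+2) tnth c i *: tnth e i))%:E =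
  (2 * ball_const R k.+1 / b ^+ k)%:E *
  \int[mu]_y (psi y * (ppow p (y - 1) * ppow p (1 + 2 * b - y)))%:E)%E.
Proof.
move=> oe xe x1 b; set r := enorm x in b *.
have r0 : 0 < r by rewrite (lt_trans _ x1).
have b0 : 0 < b by rewrite !mulr_gt0// subr_gt0.
pose a i := dotp x (tnth e i).
have xE : x = \sum_(i < k.+2) a i *: tnth e i by exact: orthonormal_sumE.
have ra : r ^+ 2 = \sum_(i < k.+2) a i ^+ 2 by rewrite /r xE sqr_enorm_sum.
(* Coordinates of x/|x| in the given basis. As any unit linear form is allowed, the basis need not
   be adapted to x. *)
pose e' i := a i / r.
have e'1 : l2norm e' = 1.
  rewrite /l2norm /e'; under eq_bigr do rewrite expr_div_n.
  by rewrite -mulr_suml -ra divff ?sqrtr1// expf_eq0 gt_eqF.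
have Sc (c : k.+2.-tuple R) : unit_sphere c -> sqnorm c = 1.
  move=> c1; have : l2norm (tnth c) ^+ 2 = 1 by rewrite c1 expr1n.
  by rewrite l2normE sqr_sqrtr// sqnorm_ge0.
have zE (c : k.+2.-tuple R) : unit_sphere c ->
    enorm (x + (r - 1) *: \sum_(i < k.+2) tnth c i *: tnth e i) ^+ 2 =
    1 + b + b * linform e' c.
  move=> /Sc c1.
  have -> : x + (r - 1) *: \sum_(i < k.+2) tnth c i *: tnth e i =
      \sum_(i < k.+2) (a i + (r - 1) * tnth c i) *: tnth e i.
    rewrite {1}xE scaler_sumr -big_split; apply: eq_bigr => i _ /=.
    by rewrite scalerA scalerDl.
  rewrite sqr_enorm_sum//.
  transitivity (r ^+ 2 + 2 * (r - 1) * (r * linform e' c) + (r - 1) ^+ 2 * sqnorm c).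
    rewrite ra /linform /sqnorm !mulr_sumr -!big_split; apply: eq_bigr => i _ /=.
    by rewrite /e'; field; rewrite gt_eqF.
  by rewrite c1 /b; ring.
have z1 (c : k.+2.-tuple R) : unit_sphere c -> 1 <= 1 + b + b * linform e' c.
  move=> /Sc c1.
  have : 0 <= \sum_(i < k.+2) (e' i + tnth c i) ^+ 2.
    by apply: sumr_ge0 => i _; exact: sqr_ge0.
  have -> : \sum_(i < k.+2) (e' i + tnth c i) ^+ 2 =
      l2norm e' ^+ 2 + 2 * linform e' c + sqnorm c.
    rewrite /l2norm sqr_sqrtr; last by apply: sumr_ge0 => i _; exact: sqr_ge0.
    rewrite /linform /sqnorm mulr_sumr -!big_split; apply: eq_bigr => i _ /=.
    by ring.
  rewrite e'1 c1 => h; have : 0 <= b * (1 + linform e' c).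
    by rewrite mulr_ge0 ?(ltW b0)//; lra.
  by lra.
(* The value 1 joins the exceptional set: the squared norm is at least 1, while [f] is radial only
   where the norm exceeds 1. *)
rewrite (@integral_zonal _ k e' b e'1 b0 _ psi (N `|` [set 1])) //.
- exact: measurableU.
- apply/eqP; rewrite -measure_le0 (le_trans (measureU2 _ _ _))//.
  by rewrite /= N0 add0e lebesgue_measure_set1.
- move=> c Scc /not_orP[]; have := z1 c Scc; rewrite -(zE c Scc).
  set u := enorm _ => u1 uN un1; apply: fpsi => //.
  rewrite -/u -(@ltr_pXn2r _ 2) ?nnegrE ?ler01 ?sqrtr_ge0// expr1n.
  by rewrite lt_neqAle u1 andbT; apply/eqP => /esym.
Qed.

Let phi (y : R) : R := psi y * ppow p (y - 1).

(** Since 1 + 2 b = t^2, the density [w] contains the kernel of a fractional integral evaluated at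
    t^2. Dividing the zonal constant by the area of the sphere of R^(k+2) gives the stated factor;
    the remaining 1/Gamma(p) belongs to [fracint]. *)
Lemma Qminus_fracint (x : 'rV[R]_n) (xi : {vspace 'rV[R]_n}) :
  1 < enorm x -> x \in xi -> \dim xi = k.+2 ->
  let t := 2 * enorm x - 1 in
  Qminus f x xi = Gamma (k.+2%:R / 2) / pi `^ (1 / 2) / ((t ^+ 2 - 1) / 2) ^+ k *
    fracint phi p (t ^+ 2).
Proof.
move=> x1 xxi dxi t.
rewrite /Qminus /sphere_integral.
have [e0 oe0 e0xi] := exists_orthonormal (erefl (\dim xi)).
have := @xgetPex _ [tuple of nseq (\dim xi) 0] [set e | orthonormal_basis e]
  (ex_intro _ e0 (conj oe0 e0xi)).
set e := xget _ _; case => oe exi; rewrite -[in x \in _]exi in xxi.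
(* The type of [e] mentions [\dim xi], so [e] is generalized before the dimension is replaced. *)
move: e oe xxi {exi}; rewrite dxi => e oe xxi.
rewrite /Rintegral (sphere_integralE oe xxi x1).
set b := 2 * enorm x * (enorm x - 1).
have bE : (t ^+ 2 - 1) / 2 = b by rewrite /t /b; field.
have tE : t ^+ 2 = 1 + 2 * b by rewrite -bE; field.
have b0 : 0 < b by rewrite !mulr_gt0 ?subr_gt0// (lt_trans _ x1).
rewrite bE /fracint tE.
have -> : (\int[mu]_y (phi y * ppow p (1 + 2 * b - y))%:E =
    \int[mu]_y (psi y * (ppow p (y - 1) * ppow p (1 + 2 * b - y)))%:E)%E.
  by apply: eq_integral => y _; rewrite /phi mulrA.
(* Infinite integrals are covered too: their finite part is 0 on both sides. *)
have fineZ c (z : \bar R) : 0 < c -> fine (c%:E * z)%E = c * fine z.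
  move=> c0; case: z => [z| |] //=.
  - by rewrite gt0_muley ?lte_fin//= mulr0.
  - by rewrite gt0_muleNy ?lte_fin//= mulr0.
rewrite fineZ; last by rewrite divr_gt0 ?exprn_gt0// mulr_gt0// ball_const_gt0.
rewrite /sphere_total_area /ball_const.
have -> : pi `^ (k.+2%:R / 2) = pi `^ (k.+1%:R / 2) * pi `^ (1 / 2) :> R.
  rewrite -powRD ?(gt_eqF (pi_gt0 _)) ?implybT//; congr powR.
  by rewrite -[in LHS]natr1; field.
move: (Gamma_halfn_gt0 R k) (Gamma_halfn_gt0 R k.+1).
have q0 : 0 < pi `^ (k.+1%:R / 2) :> R by rewrite powR_gt0// pi_gt0.
have q1 : 0 < pi `^ (1 / 2) :> R by rewrite powR_gt0// pi_gt0.
rewrite -/p; move: (fine _) (Gamma _) (Gamma _) (b ^+ k) (exprn_gt0 k b0) => I g1 g2 bk bk0 g10 g20.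
by field; rewrite !gt_eqF.
Qed.

End spherical_mean.

(** The condition on Q_- determines [Phi] on ]1, +oo[: as 2 <= k <= n, every t > 1 is 2|x| - 1 for
    some x with a k-dimensional subspace containing it. Hence [H] is determined for v > 1. *)
Theorem theorem3p14 (R : realType) (n k : nat)
    (f : 'rV[R]_n -> R) (f0 : R -> R) :
  (2 <= k <= n)%N ->
  (forall y : 'rV[R]_n, 1 < enorm y -> f y = f0 (enorm y)) ->
  Lebesgue_measurable [set s | 1 < s] f0 ->
  (forall A : R, 1 < A ->
    (\int[lebesgue_measure]_(s in `]1%R, A[)
       (`|f0 s| * (s ^+ 2 - 1) `^ ((k%:R - 3) / 2) * s)%:E < +oo)%E) ->
  exists Phi : R -> R,
    (forall (x : 'rV[R]_n) (xi : {vspace 'rV[R]_n}),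
       1 < enorm x -> x \in xi -> \dim xi = k ->
       Qminus f x xi = Phi (2 * enorm x - 1)) /\
    let H := fun v : R =>
      pi `^ (1 / 2) / Gamma (k%:R / 2) * ((v - 1) / 2) ^+ (k - 2) *
      Phi (Num.sqrt v) in
    {ae lebesgue_measure, forall s : R, 1 < s ->
       RL_derivable ((k%:R - 1) / 2) 1 H (s ^+ 2) /\
       f0 s = (s ^+ 2 - 1) `^ ((3 - k%:R) / 2) *
              RL_derivative ((k%:R - 1) / 2) 1 H (s ^+ 2)}.
Proof.
(* From here on [k] is the dimension of the subspaces minus 2. *)
case: k => [//|[//|k]] _ ff0 [g mg f0g] f0loc.
rewrite (_ : (k.+2 - 2)%N = k); last by rewrite subn2.
have -> : (k.+2%:R - 1) / 2 = k.+1%:R / 2 :> R by rewrite -[k.+2%:R]natr1 addrK.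
set p : R := k.+1%:R / 2.
have pE : (k.+2%:R - 3) / 2 = p - 1.
  by rewrite /p -[k.+2%:R]natr1; field.
have pE' : (3 - k.+2%:R) / 2 = - (p - 1) by rewrite -pE; field.
have mD : measurable [set s : R | 1 < s].
  by rewrite -set_itvoy; exact: measurable_itv.
have [M [mM M0 fgM]] := f0g.
have {f0g} f0g s : 1 < s -> ~ M s -> f0 s = g s.
  by move=> s1 Ms; apply: contrapT => fg; apply/Ms/fgM => /= /(_ s1).
(* A Borel version of [f0], extended by 0 so that [psi] and [phi] are Borel on the whole line. *)
pose g1 : R -> R := g \_ [set s | 1 < s].
have g1E s : 1 < s -> g1 s = g s by move=> s1; rewrite /g1 patchE mem_set.
have mg1 : measurable_fun setT g1 by exact: ((measurable_restrictT g mD).1 mg).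
have msqrt : measurable_fun setT (@Num.sqrt R).
  by apply: continuous_measurable_fun; exact: sqrt_continuous.
pose psi (y : R) := g1 (Num.sqrt y).
have mpsi : measurable_fun setT psi by exact: measurableT_comp mg1 msqrt.
pose phi (y : R) := psi y * ppow p (y - 1).
have mphi : measurable_fun setT phi by apply: measurable_funM => //; measurable_real.
have phi1 y : y <= 1 -> phi y = 0.
  by move=> y1; rewrite /phi ppow_le0 ?mulr0// subr_le0.
have phi_sqr s : 1 < s -> phi (s ^+ 2) = g s * (s ^+ 2 - 1) `^ (p - 1).
  move=> s1; have s0 : 0 < s by rewrite (lt_trans _ s1).
  by rewrite /phi /psi sqrtr_sqr gtr0_norm// g1E// ppow_gt0// subr_gt0 exprn_egt1.
have phi_loc z : (\int[lebesgue_measure]_(y in `]-oo, z]) `|phi y|%:E < +oo)%E.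
  (* The added 1 gives both A > 1 and x < A whenever 0 < x and x^2 <= z. *)
  pose A : R := Num.sqrt (Num.max z 1) + 1.
  have A1 : 1 < A by rewrite ltrDr sqrtr_gt0 lt_max ltr01 orbT.
  pose G (y : R) : \bar R := (`|phi y| * \1_`]-oo, z] y)%:E.
  have mG : measurable_fun setT G.
    apply/measurable_EFinP; apply: measurable_funM; last exact: measurable_indic.
    exact: measurableT_comp.
  have G0 y : (0 <= G y)%E by rewrite lee_fin mulr_ge0.
  have -> : (\int[lebesgue_measure]_(y in `]-oo, z]) `|phi y|%:E =
      \int[lebesgue_measure]_(y in `]0%R, +oo[) G y)%E.
    rewrite integral_mkcond [RHS]integral_mkcond; apply: eq_integral => y _.
    rewrite !patchE !mem_setE !in_itv/= andbT /G indicE mem_setE in_itv/=.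
    have [y0|y0] := ltP 0 y; first by case: ifPn; rewrite ?mulr1 ?mulr0.
    by rewrite phi1 ?normr0 ?mul0r ?if_same// (le_trans y0).
  rewrite -(ge0_integral_sqr mG G0).
  pose h (x : R) : R := `|g1 x| * (x ^+ 2 - 1) `^ (p - 1) * x.
  have mh : measurable_fun setT h.
    apply: measurable_funM => //; apply: measurable_funM.
      exact: measurableT_comp.
    by apply: (measurableT_comp (measurable_powR _)); measurable_real.
  have h0 x : 1 < x -> 0 <= h x.
    by move=> x1; rewrite !mulr_ge0 ?powR_ge0// ltW// (lt_trans _ x1).
  have hloc : (\int[lebesgue_measure]_(x in `]1%R, A[) (h x)%:E < +oo)%E.
    have := f0loc A A1; rewrite pE.
    (* The integrand with [f0] may fail to be Borel, so the almost everywhere comparison must not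
       require its measurability. *)
    suff -> : (\int[lebesgue_measure]_(s in `]1%R, A[)
        (`|f0 s| * (s ^+ 2 - 1) `^ (p - 1) * s)%:E =
      \int[lebesgue_measure]_(x in `]1%R, A[) (h x)%:E)%E by [].
    apply: ae_measurable_integral => //.
      exact/measurable_EFinP/measurable_funTS.
    exists M; split => // x /= /not_implyP[]; rewrite in_itv/= => /andP[x1 _].
    by move=> fh; apply: contrapT => Mx; apply: fh; rewrite /h g1E// f0g.
  apply: (@le_lt_trans _ _
    (\int[lebesgue_measure]_(x in `]1%R, A[) (2%:E * (h x)%:E))%E); last first.
    rewrite ge0_integralZl//; first by rewrite lte_mul_pinfty.
    - exact/measurable_EFinP/measurable_funTS.
    - by move=> x /=; rewrite in_itv/= => /andP[x1 _]; rewrite lee_fin h0.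
  rewrite integral_mkcond [leRHS]integral_mkcond; apply: ge0_le_integral => //.
  - move=> x _; rewrite patchE mem_setE in_itv/= andbT; case: ifPn => // x0.
    by rewrite mule_ge0// lee_fin mulr_ge0// ltW.
  - apply/(measurable_restrictT _ _).1 => //; apply: measurable_funTS.
    apply: emeasurable_funM; last by apply/measurable_EFinP; measurable_real.
    by apply: (measurableT_comp mG); measurable_real.
  - apply/(measurable_restrictT _ _).1 => //; apply: measurable_funTS.
    by apply: emeasurable_funM => //; exact/measurable_EFinP.
  move=> x _; rewrite !patchE !mem_setE !in_itv/= andbT.
  have [x0|x0] := ltP 0 x; last first.
    by rewrite (le_gtF (le_trans x0 ler01)).
  have [x1|x1] /= := ltP 1 x; last first.
    by rewrite /G phi1 ?normr0 ?mul0r ?mul0e// expr_le1// ltW.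
  rewrite /G indicE mem_setE in_itv/=; have [xz|_] := leP (x ^+ 2) z; last first.
    rewrite mulr0 mul0e; case: ifPn => // _.
    by rewrite mule_ge0// lee_fin h0.
  have -> : x < A.
    rewrite ltr_pwDr// -(gtr0_norm x0) -sqrtr_sqr ler_wsqrtr// le_max xz//.
  rewrite phi_sqr// mulr1 -!EFinM lee_fin normrM (ger0_norm (powR_ge0 _ _)) /h g1E//.
  by rewrite le_eqVlt; apply/orP; left; apply/eqP; ring.
(* The exceptional set of [f0], moved from the variable s to y = s^2. *)
pose N := `]0%R, +oo[ `&` (@Num.sqrt R) @^-1` M.
have mN : measurable N by exact: measurable_preimage_sqrt.
have N0 : lebesgue_measure N = 0%E by exact: null_preimage_sqrt.
have fpsi y : 1 < enorm y -> ~ N (enorm y ^+ 2) -> f y = psi (enorm y ^+ 2).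
  move=> y1 Ny; have y0 : 0 < enorm y by rewrite (lt_trans _ y1).
  rewrite ff0// /psi sqrtr_sqr gtr0_norm// g1E// f0g// => My; apply: Ny; split => /=.
    by rewrite in_itv/= andbT exprn_gt0.
  by rewrite sqrtr_sqr gtr0_norm.
pose Phi (t : R) := Gamma (k.+2%:R / 2) / pi `^ (1 / 2) / ((t ^+ 2 - 1) / 2) ^+ k *
  fracint phi p (t ^+ 2).
exists Phi; split.
  by move=> x xi x1 xxi dxi; rewrite (Qminus_fracint mpsi mN N0 fpsi x1 xxi dxi).
move=> H.
(* The normalization of [H] is the inverse of the factor in [Phi] at t = sqrt(v). *)
have HE v : 1 < v -> H v = fracint phi p v.
  move=> v1; rewrite /H /Phi sqr_sqrtr; last by rewrite ltW// (lt_trans _ v1).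
  have g0 := Gamma_halfn_gt0 R k.+1.
  have q0 : 0 < pi `^ (1 / 2) :> R by rewrite powR_gt0// pi_gt0.
  have b0 : 0 < ((v - 1) / 2) ^+ k by rewrite exprn_gt0// divr_gt0// subr_gt0.
  move: (Gamma _) (_ ^+ k) (pi `^ _) g0 b0 q0 => G b q G0 b0 q0.
  by field; rewrite !gt_eqF.
have [M' [mM' M'0 invM']] := ae_RL_inversion mphi phi1 phi_loc HE.
(* Inversion fails on a null set of values v; it is pulled back by v = s^2. The set [M], where [f0]
   and its Borel version may differ, is added. *)
pose S := `]0%R, +oo[ `&` (fun s : R => s ^+ 2) @^-1` M'.
have mS : measurable S.
  apply: measurableI => //.
  have msqr : measurable_fun setT (fun s : R => s ^+ 2) by measurable_real.
  by rewrite -[X in measurable X]setTI; exact: msqr.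
have S0 : lebesgue_measure S = 0%E by exact: null_preimage_sqr.
exists (M `|` S); split; first exact: measurableU.
  apply/eqP; rewrite -measure_le0.
  apply: (@le_trans _ _ (lebesgue_measure M + lebesgue_measure S)%E).
    exact: measureU2.
  by rewrite M0 S0 adde0.
move=> s /= /not_implyP[s1 Ps]; apply: contrapT => /not_orP[Ms Ms2].
have s0 : 0 < s by rewrite (lt_trans _ s1).
have s21 : 1 < s ^+ 2 by rewrite exprn_egt1.
have {Ms2}/contrapT/(_ s21)[RLs RLE] :
    ~ ~ (1 < s ^+ 2 -> RL_derivable p 1 H (s ^+ 2) /\
         RL_derivative p 1 H (s ^+ 2) = phi (s ^+ 2)).
  by move=> /invM' M's; apply: Ms2; split => //=; rewrite in_itv/= andbT.
apply: Ps; split => //; rewrite RLE phi_sqr// pE' mulrCA powRN mulVf ?mulr1 ?f0g//.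
by rewrite gt_eqF// powR_gt0// subr_gt0.
Qed.
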